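(* There is an absolute constant $C$ such that for every finite field $\mathbb{F}_q$, every $m>0$ and every degree $d$ with $q>C\cdot d$ the following holds. Suppose a points table $f:\mathbb{F}_q^m\to\mathbb{F}_q$ and a degree-$d$ lines oracle $\ell\mapsto P_\ell$ satisfy $$\Pr_{\mathbf{a}\in\mathbb{F}_q^m,\ \ell\ni\mathbf{a}}[f(\mathbf{a})\neq P_\ell(\mathbf{a})]\le\delta$$ for some $0<\delta<0.01$. Then there is an $m$-variate polynomial $Q$ of total degree at most $d$ with $\Pr_{\mathbf{a}\in\mathbb{F}_q^m}[f(\mathbf{a})\ne Q(\mathbf{a})]\le 4\delta$.
   Context: An (affine) line in $\mathbb{F}_q^m$ is a set $\ell=\{\mathbf{a}+t\mathbf{u}:t\in\mathbb{F}_q\}$ with $\mathbf{u}\neq 0$; a degree-$d$ polynomial on $\ell$ is a function on $\ell$ given, under a parametrization, by a univariate polynomial of degree at most $d$ in $t$. A degree-$d$ lines oracle assigns to every line $\ell$ a degree-$d$ polynomial $P_\ell$ on $\ell$. In probabilities, $\mathbf{a}$ is uniform and $\ell\ni\mathbf{a}$ is a uniformly random line through $\mathbf{a}$. *)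

(* Defs.v *)
From HB Require Import structures.
From mathcomp Require Import all_boot all_order all_algebra all_field.
From mathcomp Require Import mpoly.
Set Implicit Arguments. Unset Strict Implicit. Unset Printing Implicit Defensive.
Import Order.TTheory GRing.Theory Num.Theory.
Local Open Scope ring_scope.

Definition line (F : finFieldType) (m : nat) (a u : 'rV[F]_m) : {set 'rV[F]_m} :=
  [set a + t *: u | t : F].

Definition is_line (F : finFieldType) (m : nat) (L : {set 'rV[F]_m}) : bool :=
  [exists a : 'rV[F]_m, exists u : 'rV[F]_m, (u != 0) && (L == line a u)].

(* A degree-d lines oracle: assigns to every line L a function P L on points
   which, on L and under some parametrization a + t u of L, is given by a
   univariate polynomial of degree at most d in t. Values off L are irrelevant. *)
Definition lines_oracle (F : finFieldType) (m d : nat)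
  (P : {set 'rV[F]_m} -> 'rV[F]_m -> F) : Prop :=
  forall L : {set 'rV[F]_m}, is_line L ->
    exists a u : 'rV[F]_m, exists p : {poly F},
      [/\ u != 0, L = line a u, (size p <= d.+1)%N &
          forall t : F, P L (a + t *: u) = p.[t]].

Definition lines_through (F : finFieldType) (m : nat) (a : 'rV[F]_m)
  : {set {set 'rV[F]_m}} := [set L | is_line L && (a \in L)].

Definition line_point_err (R : realFieldType) (F : finFieldType) (m : nat)
  (f : 'rV[F]_m -> F) (P : {set 'rV[F]_m} -> 'rV[F]_m -> F) : R :=
  (#|'rV[F]_m|%:R)^-1 *
  \sum_(a : 'rV[F]_m)
     (#|lines_through a|%:R)^-1 *
     #|[set L in lines_through a | f a != P L a]|%:R.

Definition mpeval (F : finFieldType) (m : nat) (Q : {mpoly F[m]}) (a : 'rV[F]_m) : F :=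
  Q.@[fun i : 'I_m => a ord0 i].

Definition point_err (R : realFieldType) (F : finFieldType) (m : nat)
  (f : 'rV[F]_m -> F) (Q : {mpoly F[m]}) : R :=
  #|[set a : 'rV[F]_m | f a != mpeval Q a]|%:R / #|'rV[F]_m|%:R.

(* Main.v *)
(** Self-correction along lines combined with the Polishchuk-Spielman bivariate test.

    After replacing each line polynomial by the one agreeing with [f] on a majority of
    the line, when it exists, consider for a fixed [x] the bilinear surface
    [x + i h1 + j h2 + i j h3]: its rows and columns are lines, uniformly distributed
    for [i, j <> 0].  On most surfaces the row and column polynomials agree on more than
    three quarters of the grid, so they come from a single [Q] of bidegree [(d, d)];
    hence the line polynomials through [x] in directions [h1] and [h2] are [Q(., 0)] and
    [Q(0, .)], and both take the value [Q(0, 0)] at [x].  The common value is [g x].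
    The same argument on the surfaces [x + i h + j h1 + i j h2] shows that [g] has
    degree at most [d] on every line, which forces total degree at most [d].

    For the bivariate test, a nonzero [E] of small bidegree vanishing on the
    disagreements makes [E] times the row (or column) polynomials the restrictions of one
    polynomial [P].  If [E] and [P] were coprime, their resultant would vanish to order
    [deg E] at too many points; so they have a common factor, which is divided out until
    [E] is constant. *)
Require Import Defs.
From HB Require Import structures.
From mathcomp Require Import all_boot all_order all_algebra all_field.
From mathcomp Require Import perm polyXY zify ring mpoly.
Set Implicit Arguments. Unset Strict Implicit. Unset Printing Implicit Defensive.
Import Order.TTheory GRing.Theory Num.Theory.
Local Open Scope ring_scope.

(** * Multiplicity of the zeros of a resultant *)

(** Each term of the Leibniz expansion takes one entry from every row, so the row bounds [w] add
    up. *)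
Lemma det_size_leq (R : comNzRingType) n (M : 'M[{poly R}]_n) (w : 'I_n -> nat) :
  (forall i j, (size (M i j) <= (w i).+1)%N) ->
  (size (\det M) <= (\sum_i w i).+1)%N.
Proof.
move=> szM; rewrite /determinant; apply: (leq_trans (size_sum _ _ _)).
apply/bigmax_leqP => s _; rewrite mulr_sign.
rewrite (fun_if (fun p : {poly R} => size p)) size_polyN if_same.
apply: leq_trans (size_prod_leq _ _) _.
have : (\sum_i size (M i (s i)) <= \sum_i (w i + 1))%N.
  by apply: leq_sum => i _; rewrite addn1.
by rewrite big_split /= sum_nat_const !card_ord muln1 leq_subLR addnS ltnS addnC.
Qed.

(* A constant change of rows turns the r kernel vectors at c into r rows
   divisible by 'X - c. *)
Lemma det_dvdp_rank (F : fieldType) n (M : 'M[{poly F}]_n) (c : F) r :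
  (\rank (map_mx (horner_eval c) M) + r <= n)%N ->
  ('X - c%:P) ^+ r %| \det M.
Proof.
set Mc := map_mx _ M => rk.
pose L := map_mx polyC (invmx (col_ebase Mc)).
have uL : \det L \is a GRing.unit.
  rewrite det_map_mx rmorph_unit // -unitmxE unitmx_inv col_ebase_unit //.
have ev : map_mx (horner_eval c) (L *m M) = pid_mx (\rank Mc) *m row_ebase Mc.
  rewrite map_mxM /= -[X in _ *m X]mulmx_ebase -/Mc !mulmxA.
  have -> : map_mx (horner_eval c) L = invmx (col_ebase Mc).
    by apply/matrixP => i j; rewrite !mxE /horner_eval hornerC.
  by rewrite mulVmx ?col_ebase_unit // mul1mx.
pose D := fun i : 'I_n => if (\rank Mc <= i)%N then 'X - c%:P else 1 : {poly F}.
pose N := \matrix_(i, j) ((L *m M) i j %/ D i).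
have LM : L *m M = diag_mx (\row_i D i) *m N.
  apply/matrixP => i j; rewrite mul_diag_mx !mxE mulrC divpK //.
  rewrite /D; case: leqP => rki; last exact: dvd1p.
  rewrite dvdp_XsubCl rootE.
  have /matrixP/(_ i j) := ev; rewrite !mxE /horner_eval => ->.
  by rewrite big1 // => k _; rewrite !mxE ltnNge rki andbF mul0r.
have := congr1 (@determinant _ _) LM; rewrite !det_mulmx det_diag => detE.
have : ('X - c%:P) ^+ r %| \det L * \det M.
  rewrite detE; apply: dvdp_mulr.
  under eq_bigr => i _ do rewrite mxE.
  rewrite (bigID (fun i : 'I_n => (\rank Mc <= i)%N)) /=; apply: dvdp_mulr.
  rewrite (eq_bigr (fun=> 'X - c%:P)); last by move=> i ri; rewrite /D ri.
  rewrite prodr_const; apply: dvdp_exp2l.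
  rewrite -sum1_card.
  rewrite -(big_mkord (fun i => \rank Mc <= i)%N (fun=> 1%N)) /=.
  have rn : (\rank Mc <= n)%N by lia.
  rewrite (big_cat_nat (n := \rank Mc)) //= [X in (X + _)%N]big_nat_cond big_pred0 ?add0n; last first.
    by move=> i; lia.
  rewrite big_nat_cond (eq_bigl (fun i => (\rank Mc <= i < n) && true)%N); last by move=> i; lia.
  rewrite -big_nat_cond sum_nat_const_nat; lia.
move: uL; rewrite poly_unitE => /andP[/size_poly1P[e e0 ->] _].
by rewrite mul_polyC dvdpZr.
Qed.

(** Powers of distinct linear factors are pairwise coprime, so their product divides [p]. *)
Lemma size_dvdp_multiroot (F : fieldType) (p : {poly F}) (s : seq F) r :
  p != 0 -> uniq s -> (forall c, c \in s -> ('X - c%:P) ^+ r %| p) ->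
  (size s * r < size p)%N.
Proof.
move=> p0 us dv.
have dvp : \prod_(c <- s) ('X - c%:P) ^+ r %| p.
  elim: s us dv => [|c s IHs] /=; first by rewrite big_nil dvd1p.
  case/andP=> cs us dv; rewrite big_cons Gauss_dvdp.
    by rewrite dv ?mem_head //= IHs // => e es; rewrite dv // inE es orbT.
  apply: coprimep_expl; rewrite coprimep_sym.
  elim: s cs us {IHs dv} => [|e s IHs] /=; first by rewrite big_nil coprime1p.
  rewrite inE negb_or => /andP[ce cs] /andP[_ us]; rewrite big_cons coprimepMl.
  by rewrite IHs // coprimep_expl // coprimep_XsubC root_XsubC ce.
have /(dvdp_leq p0) := dvp.
suff -> : size (\prod_(c <- s) ('X - c%:P) ^+ r) = (size s * r).+1 by [].
rewrite prodrXl; elim: r {dv dvp} => [|r IHr].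
  by rewrite expr0 size_poly1 muln0.
have np k : \prod_(c <- s) ('X - c%:P) ^+ k != 0.
  by rewrite prodf_seq_neq0; apply/allP => c _ /=; rewrite expf_neq0 ?polyXsubC_eq0.
rewrite exprS size_mul ?IHr -?prodrXl ?np // -1?[\prod_(i <- s) _]/(\prod_(i <- s) ('X - i%:P)).
  by rewrite size_prod_XsubC mulnS; lia.
by have := np 1%N; under eq_bigr do rewrite expr1.
Qed.

(** * Common factors of bivariate polynomials *)

Lemma irreducible_factor (F : finFieldType) (c : {poly F}) :
  c != 0 -> (1 < size c)%N -> exists2 r, irreducible_poly r & r %| c.
Proof.
move=> c0 sc.
(* A nonconstant divisor of least size is irreducible; coding divisors as row vectors over a finite
   field makes their existence decidable. *)
pose Q n := (1 < n)%N && [exists v : 'rV[F]_n, (size (rVpoly v) == n) && (rVpoly v %| c)].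
have QI (q : {poly F}) : (1 < size q)%N -> q %| c -> Q (size q).
  move=> sq qc; rewrite /Q sq; apply/existsP; exists (poly_rV q).
  by rewrite poly_rV_K // eqxx.
have exQ : exists n, Q n by exists (size c); apply: QI.
case: (ex_minnP exQ) => n /andP[n1 /existsP[v /andP[/eqP sv vc]]] minn.
exists (rVpoly v) => //; split; rewrite ?sv // => q q1 qv.
have qc := dvdp_trans qv vc.
have q0 : q != 0 by apply: contraTneq qc => ->; rewrite dvd0p.
rewrite -dvdp_size_eqp // eqn_leq dvdp_leq ?sv //=; last by rewrite -size_poly_gt0 sv; lia.
by rewrite minn // QI //; move: q0 q1; rewrite -size_poly_gt0; case: (size q) => [|[]].
Qed.

Lemma dvdp_coef_scale (F : fieldType) (r : {poly F}) (A : {poly {poly F}}) :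
  (forall k, r %| A`_k) -> exists A', A = r *: A'.
Proof.
move=> rA; exists (\poly_(k < size A) (A`_k %/ r)); apply/polyP => k.
rewrite coefZ coef_poly; case: ltnP => [_|/leq_sizeP/(_ k (leqnn _))->].
  by rewrite mulrC divpK.
by rewrite mulr0.
Qed.

(** Gauss's lemma. Otherwise let [i] and [j] be the first indices at which [r] fails to divide a
    coefficient of [A] and of [B]; in the coefficient [i + j] of the product every term but one is
    divisible by [r]. *)
Lemma gauss_irreducible (F : finFieldType) (r : {poly F}) (A B M : {poly {poly F}}) :
  irreducible_poly r -> A * B = r *: M ->
  (exists A', A = r *: A') \/ (exists B', B = r *: B').
Proof.
move=> irr ABM.
have dec (D : {poly {poly F}}) : (forall k, r %| D`_k) \/ exists2 i, ~~ (r %| D`_i) & forall k, (k < i)%N -> r %| D`_k.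
  case: (boolP [forall k : 'I_(size D), r %| D`_k]) => [/forallP h|].
    left=> k; case: (ltnP k (size D)) => [lk|/(nth_default 0)->]; last exact: dvdp0.
    exact: (h (Ordinal lk)).
  case/forallPn => k0 hk0; right.
  have ex : exists i, ~~ (r %| D`_i) by exists k0.
  case: (ex_minnP ex) => i hi mi; exists i => // k ki.
  by apply/negPn/negP => /mi; rewrite leqNgt ki.
have prime p q : r %| p * q -> (r %| p) || (r %| q).
  move=> rpq; case: (boolP (r %| p)) => //= rp.
  have cp : coprimep r p.
    rewrite coprimep_def; apply/negPn/negP => g1.
    have /(irr.2 _ g1) /eqp_dvdl e := dvdp_gcdl r p.
    by move: rp; rewrite -e dvdp_gcdr.
  by rewrite -(Gauss_dvdpr _ cp).
case: (dec A) => [/dvdp_coef_scale|[i Ai mA]]; first by left.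
case: (dec B) => [/dvdp_coef_scale|[j Bj mB]]; first by right.
have : r %| (A * B)`_(i + j) by rewrite ABM coefZ dvdp_mulr.
rewrite coefM.
have li : (i < (i + j).+1)%N by lia.
rewrite (bigD1 (Ordinal li)) //= dvdp_addl; last first.
  apply: (big_ind (fun p => r %| p)) => [|p q rp rq|k ki]; [exact: dvdp0 | by rewrite dvdp_add |].
  case: (ltngtP k i) => [ki'|ki'|ki']; first by rewrite dvdp_mulr ?mA.
    by rewrite dvdp_mull // mB //; move: (ltn_ord k); lia.
  by case/eqP: ki; apply: val_inj.
by rewrite addKn => /prime; rewrite (negPf Ai) (negPf Bj).
Qed.

(** The denominator [c] is cleared one irreducible factor at a time: by Gauss's lemma such a factor
    cancels from [G], or else from both [S] and [T]. Being a scalar, it does not change the size of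
    [G]. *)
Lemma common_factor_clear (F : finFieldType) (c : {poly F}) (E P G S T : {poly {poly F}}) :
  c != 0 -> c *: E = G * S -> c *: P = G * T -> (1 < size G)%N ->
  exists G' E' P' : {poly {poly F}}, [/\ (1 < size G')%N, E = G' * E' & P = G' * P'].
Proof.
have [n] := ubnP (size c); elim: n c G S T => // n IHn c G S T ltn c0 cE cP sG.
have inj (r : {poly F}) : r != 0 -> injective (fun p : {poly {poly F}} => r *: p).
  by move=> r0 p q /=; rewrite -!mul_polyC; apply: mulfI; rewrite polyC_eq0.
case: (leqP (size c) 1) => [sc|sc].
  have e : c = (c`_0)%:P by apply: size1_polyC.
  have k0 : c`_0 != 0 by apply: contraNneq c0 => k0; rewrite e k0.
  have kk : ((c`_0)^-1)%:P * c = 1 by rewrite e coefC eqxx -polyCM mulVf.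
  exists G, (((c`_0)^-1)%:P *: S), (((c`_0)^-1)%:P *: T); split=> //.
    by rewrite -scalerAr -cE scalerA kk scale1r.
  by rewrite -scalerAr -cP scalerA kk scale1r.
have [r irr /dvdpP[c' cc]] := irreducible_factor c0 sc.
have r0 := irredp_neq0 irr.
have c'0 : c' != 0 by apply: contraNneq c0 => z; rewrite cc z mul0r.
have szc : (size c' < n)%N.
  have := irr.1; move: ltn; rewrite cc size_mul //; move: (size r) (size c'); lia.
have cE' : G * S = r *: (c' *: E) by rewrite scalerA [r * _]mulrC -cc.
have cP' : G * T = r *: (c' *: P) by rewrite scalerA [r * _]mulrC -cc.
have onG (G' : {poly {poly F}}) : G = r *: G' -> exists G' E' P' : {poly {poly F}}, [/\ (1 < size G')%N, E = G' * E' & P = G' * P'].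
  move=> eG; apply: (IHn c' G' S T) => //; last by rewrite eG size_scale in sG.
    by apply: (inj _ r0); rewrite -cE' eG scalerAl.
  by apply: (inj _ r0); rewrite -cP' eG scalerAl.
case: (gauss_irreducible irr cE') => [[G' /onG //]|[S' eS]].
case: (gauss_irreducible irr cP') => [[G' /onG //]|[T' eT]].
apply: (IHn c' G S' T') => //.
  by apply: (inj _ r0); rewrite -cE' eS scalerAr.
by apply: (inj _ r0); rewrite -cP' eT scalerAr.
Qed.

(** Over the coefficient ring [{poly F}] the gcd divides [E] and [P] only up to scalar multiples,
    which [common_factor_clear] removes. *)
Lemma resultant0_common_factor (F : finFieldType) (E P : {poly {poly F}}) :
  resultant E P = 0 ->
  exists G E' P' : {poly {poly F}}, [/\ (1 < size G)%N, E = G * E' & P = G * P'].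
Proof.
move/eqP; rewrite resultant_eq0 => sG.
have /Pdiv.WeakIdomain.dvdpP[[c S] /= c0 cE] := dvdp_gcdl E P.
have /Pdiv.WeakIdomain.dvdpP[[c' T] /= c'0 cP] := dvdp_gcdr E P.
apply: (@common_factor_clear F (c * c') E P (gcdp E P) (c' *: S) (c *: T)) => //.
- by rewrite mulf_neq0.
- by rewrite mulrC -scalerA cE -scalerAr [S * _]mulrC.
- by rewrite -scalerA cP -scalerAr [T * _]mulrC.
Qed.

Lemma poly_sum_coef (R : nzRingType) n (p : {poly R}) :
  (size p <= n)%N -> p = \sum_(l < n) p`_l *: 'X^l.
Proof.
move=> sp; rewrite -poly_def; apply/polyP => k; rewrite coef_poly.
by case: ltnP => // nk; rewrite nth_default // (leq_trans sp).
Qed.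

(** At [c], [P] is a multiple of [E] with quotient of degree at most [d], so each row of the
    Sylvester matrix coming from [P] is a combination of the [(size P).-1] rows coming from [E]. *)
Lemma Sylvester_rank_eval (F : fieldType) (E P : {poly {poly F}}) (c : F) (B : {poly F}) d :
  E != 0 -> size P = (size E + d)%N -> (size B <= d.+1)%N ->
  map_poly (horner_eval c) P = map_poly (horner_eval c) E * B ->
  (\rank (map_mx (horner_eval c) (Sylvester_mx E P)) <= (size P).-1)%N.
Proof.
move=> E0 szP szB ePE; set Ec := map_poly _ E in ePE; set Pc := map_poly _ P in ePE.
set nP := (size P).-1; set nE := (size E).-1.
pose T := \matrix_(k < nP, j < nP + nE) ('X^k * Ec)`_j.
pose W := \matrix_(k < nE, l < nP) ('X^k * B)`_l.
have -> : map_mx (horner_eval c) (Sylvester_mx E P) = col_mx 1%:M W *m T.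
  rewrite mul_col_mx mul1mx /Sylvester_mx map_col_mx; congr col_mx; apply/matrixP => k j.
    by rewrite !mxE /= rVpoly_delta !coefXnM (fun_if (horner_eval c)) coef_map rmorph0.
  rewrite !mxE /= rVpoly_delta.
  transitivity (('X^k * Pc)`_j).
    by rewrite !coefXnM (fun_if (horner_eval c)) coef_map rmorph0.
  under eq_bigr => l _ do rewrite !mxE.
  have szk : (size ('X^k * B)%R <= nP)%N.
    apply: leq_trans (size_polyMleq _ _) _; rewrite size_polyXn /nP szP.
    have := ltn_ord k; move: szB E0; rewrite -size_poly_gt0.
    move: (size E) (size B) (nat_of_ord k); lia.
  have -> : 'X^k * Pc = \sum_(l < nP) ('X^k * B)`_l *: ('X^l * Ec).
    rewrite ePE mulrCA mulrC {1}(poly_sum_coef szk) mulr_suml.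
    by apply: eq_bigr => l _; rewrite scalerAl.
  by rewrite coef_sum; apply: eq_bigr => l _; rewrite coefZ.
by apply: leq_trans (mulmx_max_rank _ _) _.
Qed.

(** The rank defect makes the resultant vanish to order [(size E).-1] at each point of [s]; the last
    hypothesis says that these zeros outnumber its degree. *)
Lemma resultant_eq0_of_evals (F : fieldType) (E P : {poly {poly F}}) d e (s : seq F) :
  E != 0 -> size P = (size E + d)%N ->
  (sizeY E <= e.+1)%N -> (sizeY P <= (e + d).+1)%N -> uniq s ->
  (forall c, c \in s -> exists2 B : {poly F}, (size B <= d.+1)%N &
     map_poly (horner_eval c) P = map_poly (horner_eval c) E * B) ->
  ((size P).-1 * e + (size E).-1 * (e + d) < size s * (size E).-1)%N ->
  resultant E P = 0.
Proof.
move=> E0 szP sE sP us evs lt.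
apply/eqP/negPn/negP => r0.
have dv : forall c, c \in s -> ('X - c%:P) ^+ (size E).-1 %| resultant E P.
  move=> c cs; have [B szB eB] := evs c cs.
  apply: det_dvdp_rank; rewrite leq_add2r; exact: (Sylvester_rank_eval E0 szP szB eB).
(* The first [(size P).-1] rows hold coefficients of [E], the remaining ones coefficients of [P]. *)
pose w (i : 'I_((size P).-1 + (size E).-1)) := if split i is inl _ then e else (e + d)%N.
have wP i j : (size (Sylvester_mx E P i j) <= (w i).+1)%N.
  rewrite Sylvester_mxE /w; case: split => k /=.
    by case: (k <= j)%N; [apply: leq_trans (max_size_coefXY _ _) _ | rewrite size_poly0].
  by case: (k <= j)%N; [apply: leq_trans (max_size_coefXY _ _) _ | rewrite size_poly0].
have := det_size_leq wP; rewrite -/(resultant E P) big_split_ord /=.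
under eq_bigr => i _ do rewrite /w (unsplitK (inl i)).
under [X in (_ + X)%N]eq_bigr => i _ do rewrite /w (unsplitK (inr i)).
rewrite !sum_nat_const !card_ord => h1.
have h2 := size_dvdp_multiroot r0 us dv.
by have := leq_trans h2 h1; rewrite ltnS leqNgt lt.
Qed.

(** * The bivariate test *)

(** In this part the outer variable of [{poly {poly F}}] is x and the inner one y. For
    [k >= size E + d] the coefficient of x^k in [P] vanishes at every point of [J], hence
    identically. *)
Lemma size_quotient_leq (F : fieldType) (E P : {poly {poly F}}) (B : F -> {poly F}) (J : seq F) d :
  (forall y, (size (B y) <= d.+1)%N) -> uniq J -> (sizeY P <= size J)%N ->
  (forall y, y \in J -> (swapXY P).[y%:P] = (swapXY E).[y%:P] * B y) ->
  (size P <= size E + d)%N.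
Proof.
move=> szB uJ szJ hJ; apply/leq_sizeP => k lek.
apply: (@roots_geq_poly_eq0 _ _ J) => //; last exact: leq_trans (max_size_coefXY _ _) szJ.
apply/allP => y yJ; rewrite rootE; apply/eqP.
have := congr1 (fun p : {poly F} => p`_k) (hJ y yJ).
rewrite !horner_swapXY coef_map /= /horner_eval => ->.
rewrite nth_default //; apply: leq_trans (size_polyMleq _ _) _.
have h1 : (size (map_poly (horner_eval y) E) <= size E)%N by apply: size_poly.
have h2 := szB y; move: h1 h2 lek.
move: (size (map_poly _ E)) (size E) (size (B y)); lia.
Qed.

(** The resultant with respect to x is a polynomial in y with a zero of order deg_x [E] at each
    point of [J]. Eliminating the variable in which [E] has the larger degree makes these zeros
    exceed the degree of the resultant. *)
Lemma descent_common_factor (F : finFieldType) (E P : {poly {poly F}}) (B : F -> {poly F})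
    (J : seq F) d :
  (forall y, (size (B y) <= d.+1)%N) -> uniq J -> E != 0 ->
  (forall y, y \in J -> (swapXY P).[y%:P] = (swapXY E).[y%:P] * B y) ->
  (size P <= size E + d)%N -> (sizeY P <= sizeY E + d)%N ->
  (sizeY E <= size E)%N -> (1 < size E)%N -> (2 * (sizeY E).-1 + 2 * d < size J)%N ->
  exists G E' P' : {poly {poly F}}, [/\ (1 < size G)%N, E = G * E' & P = G * P'].
Proof.
move=> szB uJ E0 hJ sP sYP leYX sE ltJ.
(* Adding [X^d E] to [P] makes the degree of the second argument of the resultant
   exactly [deg E + d], so that the Sylvester matrix has the full rank defect [deg E]
   at every [y] in [J], including those where the leading coefficient of [E] vanishes. *)
pose P1 := P + (if size P == (size E + d)%N then 0 else 'X^d * E).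
pose B1 y := B y + (if size P == (size E + d)%N then 0 else 'X^d).
have szXE : size ('X^d * E) = (size E + d)%N by rewrite mulrC size_mulXn // addnC.
have szP1 : size P1 = (size E + d)%N.
  rewrite /P1; case: eqP => [e|/eqP ne]; first by rewrite addr0.
  by rewrite addrC size_polyDl ?szXE //; rewrite ltn_neqAle ne.
have szB1 y : (size (B1 y) <= d.+1)%N.
  rewrite /B1; apply: leq_trans (size_polyD _ _) _; rewrite geq_max szB /=.
  by case: ifP; rewrite ?size_poly0 ?size_polyXn.
have sY0 : (0 < sizeY E)%N by rewrite lt0n sizeY_eq0.
have sYP1 : (sizeY P1 <= ((sizeY E).-1 + d).+1)%N.
  rewrite sizeYE /P1 rmorphD /=; apply: leq_trans (size_polyD _ _) _.
  rewrite -!sizeYE geq_max; apply/andP; split; first by move: sYP sY0; move: (sizeY E) (sizeY P); lia.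
  case: ifP => _; first by rewrite sizeYE raddf0 size_poly0.
  have -> : sizeY ('X^d * E) = sizeY E.
    elim: d {P1 szB sP sYP ltJ B1 szXE szP1 szB1} => [|k IH]; first by rewrite expr0 mul1r.
    by rewrite exprSr -mulrA ['X * _]mulrC mulrA sizeY_mulX.
  by move: sY0; move: (sizeY E); lia.
have [|G [E' [P' [sG eE eP]]]] := @resultant0_common_factor _ E P1.
  apply: (@resultant_eq0_of_evals _ _ _ d (sizeY E).-1 J) => //.
  - by rewrite prednK.
  - move=> y yJ; exists (B1 y) => //.
    have := hJ y yJ; rewrite !horner_swapXY /P1 /B1 rmorphD /= => ->.
    rewrite mulrDr; congr (_ + _); case: ifP => _; first by rewrite rmorph0 mulr0.
    by rewrite rmorphM /= map_polyXn mulrC.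
  (* With e and e' the degrees of [E] in x and y, the resultant has degree at most (e + d) e' + e
     (e' + d), and e' <= e bounds this by e (2 e' + 2 d). *)
  - rewrite szP1; move: ltJ leYX sE sY0; move: (size E) (sizeY E) (size J).
    by move=> b al j h1 h2 h3 h4; nia.
(* [P1] differs from [P] by a multiple of [E], so [G] divides [P] as well. *)
exists G, E', (P' - (if size P == (size E + d)%N then 0 else 'X^d * E')); split=> //.
rewrite mulrBr -eP /P1; case: ifP => _; first by rewrite mulr0 subr0 addr0.
by rewrite mulrCA -eE addrK.
Qed.

Lemma size_filter_nonroot (F : fieldType) (G : {poly {poly F}}) (I : seq F) :
  uniq I -> G != 0 ->
  (size I <= size [seq x <- I | G.[x%:P] != 0%R] + (size G).-1)%N.
Proof.
move=> uI G0; rewrite size_filter -(count_predC (fun x => G.[x%:P] != 0) I) leq_add2l.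
have -> : count (predC (fun x => G.[x%:P] != 0)) I
          = size (map polyC [seq x <- I | G.[x%:P] == 0]).
  by rewrite size_map size_filter; apply: eq_count => x /=; rewrite negbK.
rewrite -ltnS prednK ?size_poly_gt0 //; apply: max_poly_roots => //.
  by apply/allP => p /mapP[x]; rewrite mem_filter => /andP[gx _] ->; rewrite rootE.
by rewrite map_inj_uniq ?filter_uniq //; apply: polyC_inj.
Qed.

Lemma size_mul_factor (R : idomainType) (G P : {poly R}) :
  G != 0 -> (size P <= size (G * P)%R)%N.
Proof.
move=> G0; case: (eqVneq P 0) => [->|P0]; first by rewrite size_poly0.
rewrite size_mul //; move: G0 P0; rewrite -!size_poly_gt0.
move: (size G) (size P); lia.
Qed.

(** Induction on the degrees of [E], dividing [E] and [P] by a common factor until [E] is constant.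
    The slack deg [E] in the sizes of [I] and [J] pays for the rows and columns on which the factor
    vanishes. *)
Lemma rational_interpolant_polynomial (F : finFieldType) (d a N : nat) (A B : F -> {poly F})
    (E P : {poly {poly F}}) (I J : seq F) :
  (forall x, (size (A x) <= d.+1)%N) -> (forall y, (size (B y) <= d.+1)%N) ->
  uniq I -> uniq J -> E != 0 ->
  (size E <= a.+1)%N -> (sizeY E <= a.+1)%N ->
  (a + 2 * d < N)%N -> (size P <= N)%N -> (sizeY P <= N)%N ->
  (N + (size E).-1 <= size I)%N -> (N + (sizeY E).-1 <= size J)%N ->
  (forall x, x \in I -> P.[x%:P] = E.[x%:P] * A x) ->
  (forall y, y \in J -> (swapXY P).[y%:P] = (swapXY E).[y%:P] * B y) ->
  exists Q : {poly {poly F}},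
    [/\ (size Q <= d.+1)%N, (sizeY Q <= d.+1)%N,
        (N <= count (fun x => Q.[x%:P] == A x) I)%N &
        (N <= count (fun y => (swapXY Q).[y%:P] == B y) J)%N].
Proof.
move=> szA szB; have [n] := ubnP (size E + sizeY E).
elim: n E P I J => // n IHn E P I J ltn uI uJ E0 sE sYE ltN sP sYP sI sJ hI hJ.
have sE0 : (0 < size E)%N by rewrite size_poly_gt0.
have sY0 : (0 < sizeY E)%N by rewrite lt0n sizeY_eq0.
have sP' : (size P <= size E + d)%N.
  by apply: size_quotient_leq hJ => //; apply: leq_trans sYP (leq_trans (leq_addr _ _) sJ).
have sYP' : (sizeY P <= sizeY E + d)%N.
  rewrite !sizeYE; apply: (size_quotient_leq szA uI); last by move=> x /hI; rewrite !swapXYK.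
  by rewrite sizeYE swapXYK; apply: leq_trans sP (leq_trans (leq_addr _ _) sI).
(* Both sizes are positive, so a sum of at most 2 means that [E] is a nonzero constant, and [P]
   divided by it is the required [Q]. *)
case: (leqP (size E + sizeY E) 2) => [cE|cE].
  have [k k0 eE] : exists2 k : F, k != 0 & E = k%:P%:P.
    have sE1 : (size E <= 1)%N by move: cE sY0; lia.
    have e1 : E = (E`_0)%:P by apply: size1_polyC.
    have e2 : E`_0 = (E`_0`_0)%:P.
      apply: size1_polyC; apply: leq_trans (max_size_coefXY _ _) _.
      by move: cE sE0; lia.
    exists (E`_0`_0); last by rewrite {1}e1 {1}e2.
    by apply: contraNneq E0 => z; rewrite e1 e2 z.
  have Qx x : (k^-1%:P%:P * P).[x%:P] = k^-1%:P * P.[x%:P] by rewrite hornerCM.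
  have Qy y : (swapXY (k^-1%:P%:P * P)).[y%:P] = k^-1%:P * (swapXY P).[y%:P].
    by rewrite rmorphM /= swapXY_polyC map_polyC hornerCM.
  have kk : k^-1%:P * k%:P = 1 :> {poly F} by rewrite -polyCM mulVf.
  have k1 : k^-1%:P%:P != 0 :> {poly {poly F}} by rewrite !polyC_eq0 invr_eq0.
  exists (k^-1%:P%:P * P); split.
  - rewrite mul_polyC size_scale ?polyC_eq0 ?invr_eq0 //.
    by move: sP' cE sY0; move: (size P) (size E) (sizeY E); lia.
  - rewrite sizeYE rmorphM /= swapXY_polyC map_polyC mul_polyC.
    rewrite size_scale ?polyC_eq0 ?invr_eq0 // -sizeYE.
    by move: sYP' cE sE0; move: (sizeY P) (size E) (sizeY E); lia.
  - rewrite (_ : count _ I = size I) ?(leq_trans (leq_addr _ _) sI) //.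
    apply/eqP; rewrite -all_count; apply/allP => x xI.
    by rewrite Qx hI // eE hornerC mulrA kk mul1r.
  - rewrite (_ : count _ J = size J) ?(leq_trans (leq_addr _ _) sJ) //.
    apply/eqP; rewrite -all_count; apply/allP => y yJ.
    by rewrite Qy hJ // eE swapXY_polyC map_polyC hornerC mulrA kk mul1r.
have [G [E' [P' [sG eE eP]]]] : exists G E' P' : {poly {poly F}},
    [/\ (1 < size G)%N || (1 < sizeY G)%N, E = G * E' & P = G * P'].
  (* The variable of larger degree is eliminated, after exchanging x and y if necessary. *)
  case: (leqP (sizeY E) (size E)) => cmp.
    have [||G [E' [P' [sG eE eP]]]] := descent_common_factor szB uJ E0 hJ sP' sYP' cmp.
    - by move: cE cmp; lia.
    - by move: sJ ltN sYE; lia.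
    by exists G, E', P'; rewrite sG.
  have hI' x : x \in I -> (swapXY (swapXY P)).[x%:P] = (swapXY (swapXY E)).[x%:P] * A x.
    by rewrite !swapXYK; apply: hI.
  have := @descent_common_factor _ (swapXY E) (swapXY P) A I d szA uI.
  rewrite swapXY_eq0 -!sizeYE (sizeYE (swapXY E)) (sizeYE (swapXY P)) !swapXYK.
  case/(_ E0 hI sYP' sP' (ltnW cmp)) => [||G [E' [P' [sG eE eP]]]].
  - by move: cE cmp; lia.
  - by move: sI ltN sE; move: (size E) (size I); lia.
  exists (swapXY G), (swapXY E'), (swapXY P'); rewrite -!rmorphM /= -eE -eP !swapXYK.
  by rewrite sizeYE swapXYK sG orbT.
have G0 : G != 0 by apply: contraNneq E0 => z; rewrite eE z mul0r.
have E'0 : E' != 0 by apply: contraNneq E0 => z; rewrite eE z mulr0.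
have szE : size E = (size G + size E').-1 by rewrite eE size_mul.
have szYE : sizeY E = (sizeY G + sizeY E').-1.
  by rewrite !sizeYE eE rmorphM size_mul ?swapXY_eq0.
have pG : (0 < size G)%N by rewrite size_poly_gt0.
have pYG : (0 < sizeY G)%N by rewrite lt0n sizeY_eq0.
have pE' : (0 < size E')%N by rewrite size_poly_gt0.
have pYE' : (0 < sizeY E')%N by rewrite lt0n sizeY_eq0.
(* The equations can be divided by [G] only where it does not vanish identically. At most deg_x [G]
   rows and deg_y [G] columns are lost, exactly the drop in the degrees of [E]. *)
pose I' := [seq x <- I | G.[x%:P] != 0].
pose J' := [seq y <- J | (swapXY G).[y%:P] != 0].
have sI' : (size I <= size I' + (size G).-1)%N by apply: size_filter_nonroot.
have sJ' : (size J <= size J' + (sizeY G).-1)%N.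
  by rewrite sizeYE; apply: size_filter_nonroot; rewrite ?swapXY_eq0.
have [|||||||||||||Q [q1 q2 q3 q4]] := IHn E' P' I' J'.
- by move: ltn sG; rewrite szE szYE; lia.
- exact: filter_uniq.
- exact: filter_uniq.
- exact: E'0.
- by move: sE; rewrite szE; lia.
- by move: sYE; rewrite szYE; lia.
- exact: ltN.
- by apply: leq_trans sP; rewrite eP size_mul_factor.
- by apply: leq_trans sYP; rewrite !sizeYE eP rmorphM size_mul_factor ?swapXY_eq0.
- by move: sI sI' pG pE'; rewrite szE; move: (size I) (size I') (size G) (size E'); lia.
- by move: sJ sJ' pYG pYE'; rewrite szYE; move: (size J) (size J') (sizeY G) (sizeY E'); lia.
- move=> x; rewrite mem_filter => /andP[gx /hI]; rewrite eE eP !hornerM -mulrA.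
  by move/(mulfI gx).
- move=> y; rewrite mem_filter => /andP[gy /hJ]; rewrite eE eP !rmorphM !hornerM -mulrA.
  by move/(mulfI gy).
exists Q; split=> //.
  by apply: leq_trans q3 _; apply: leq_count_subseq; apply: filter_subseq.
by apply: leq_trans q4 _; apply: leq_count_subseq; apply: filter_subseq.
Qed.

(** * Interpolation and the low-degree polynomial of a grid *)

Lemma poly_eq_on (F : idomainType) (p q : {poly F}) (s : seq F) :
  uniq s -> (size p <= size s)%N -> (size q <= size s)%N ->
  (forall x, x \in s -> p.[x] = q.[x]) -> p = q.
Proof.
move=> us sp sq e; apply/eqP; rewrite -subr_eq0; apply/eqP.
apply: (@roots_geq_poly_eq0 _ _ s) => //.
  by apply/allP => x /e ex; rewrite rootE hornerD hornerN ex subrr.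
by apply: leq_trans (size_polyD _ _) _; rewrite size_polyN geq_max sp.
Qed.

Lemma sizeY_leqP (R : nzRingType) (u : {poly {poly R}}) b :
  (forall k, (size (u`_k)%R <= b)%N) -> (sizeY u <= b)%N.
Proof. by move=> h; apply/bigmax_leqP => i _. Qed.

(** Newton interpolation with polynomial values: a new node adds a multiple of the product that
    vanishes at the earlier ones. *)
Lemma interpolation_rows (F : fieldType) (s : seq F) (v : F -> {poly F}) b :
  uniq s -> (forall x, x \in s -> (size (v x) <= b)%N) ->
  exists P : {poly {poly F}}, [/\ (size P <= size s)%N, (sizeY P <= b)%N &
    forall x, x \in s -> P.[x%:P] = v x].
Proof.
elim: s => [_ _|z s IHs /= /andP[zs us] hv].
  by exists 0; rewrite size_poly0 sizeYE raddf0 size_poly0.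
have [|P [sP sYP eP]] := IHs us; first by move=> x xs; apply: hv; rewrite inE xs orbT.
pose w := \prod_(x <- s) ('X - x%:P).
pose c := (v z - P.[z%:P]) * (w.[z]^-1)%:P.
have wz : w.[z] != 0.
  rewrite horner_prod prodf_seq_neq0; apply/allP => x xs /=.
  by rewrite hornerXsubC subr_eq0; apply: contraNneq zs => ->.
have szc : (size c <= b)%N.
  rewrite /c mulrC mul_polyC; apply: leq_trans (size_scale_leq _ _) _.
  apply: leq_trans (size_polyD _ _) _; rewrite size_polyN geq_max hv ?mem_head //=.
  exact: leq_trans (max_size_evalC _ _) sYP.
have ev x : (c *: map_poly polyC w).[x%:P] = c * (w.[x])%:P.
  by rewrite hornerZ -horner_map /=.
exists (P + c *: map_poly polyC w); split.
- apply: leq_trans (size_polyD _ _) _; rewrite geq_max (leq_trans sP) ?leqnSn //=.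
  apply: leq_trans (size_scale_leq _ _) _.
  by rewrite size_map_polyC size_prod_XsubC.
- apply: sizeY_leqP => k; rewrite coefD coefZ coef_map /=.
  apply: leq_trans (size_polyD _ _) _; rewrite geq_max (leq_trans (max_size_coefXY _ _) sYP) /=.
  by rewrite mulrC mul_polyC (leq_trans (size_scale_leq _ _)).
- move=> x; rewrite inE hornerD ev => /orP[/eqP->|xs].
    by rewrite /c -mulrA -polyCM mulVf // mulr1 addrC subrK.
  rewrite eP // (_ : w.[x] = 0) ?mulr0 ?addr0 //.
  by rewrite horner_prod (big_rem x) //= hornerXsubC subrr mul0r.
Qed.

(** Dimension count: there are (a + 1)^2 coefficients and fewer linear conditions. *)
Lemma vanishing_bidegree (F : fieldType) (L : seq (F * F)) a :
  (size L < a.+1 * a.+1)%N ->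
  exists E : {poly {poly F}}, [/\ E != 0, (size E <= a.+1)%N, (sizeY E <= a.+1)%N &
    forall xy, xy \in L -> E.[xy.1%:P].[xy.2] = 0].
Proof.
move=> szL.
pose W (xy : F * F) := \matrix_(k < a.+1, l < a.+1) (xy.1 ^+ k * xy.2 ^+ l).
pose M := \matrix_(i < a.+1 * a.+1, p < size L) mxvec (W (nth (0, 0) L p)) 0 i.
have [v vM v0] : exists2 v : 'rV_(a.+1 * a.+1), (v <= kermx M)%MS & v != 0.
  apply/rowV0Pn; rewrite -mxrank_eq0 mxrank_ker subn_eq0 -ltnNge.
  exact: leq_ltn_trans (rank_leq_col M) szL.
pose V := vec_mx v.
pose E := \poly_(k < a.+1) rVpoly (row (inord k) V).
have cE k l : E`_(nat_of_ord k)`_(nat_of_ord l) = V k l.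
  by rewrite coef_poly ltn_ord coef_rVpoly_ord mxE inord_val.
exists E; split.
- apply: contraNneq v0 => E0; rewrite -(vec_mxK v) -/V.
  suff -> : V = 0 by rewrite linear0.
  by apply/matrixP => k l; rewrite -cE E0 !coef0 mxE.
- exact: size_poly.
- apply: sizeY_leqP => k; rewrite coef_poly; case: ifP => _; last by rewrite size_poly0.
  exact: size_poly.
- move=> xy xyL.
  have pL : (index xy L < size L)%N by rewrite index_mem.
  have /matrixP/(_ 0 (Ordinal pL)) : v *m M = 0 by apply/sub_kermxP.
  rewrite !mxE => e; rewrite -[RHS]e {e}.
  under eq_bigr => i _ do rewrite mxE /= nth_index //.
  rewrite (reindex _ (curry_mxvec_bij _ _)) /=.
  rewrite (eq_bigr (fun kl => v 0 (mxvec_index kl.1 kl.2) * mxvec (W xy) 0 (mxvec_index kl.1 kl.2)));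
    last by case.
  rewrite -(pair_bigA _ (fun k l => v 0 (mxvec_index k l) * mxvec (W xy) 0 (mxvec_index k l))) /=.
  rewrite (horner_coef_wide _ (size_poly _ _)) horner_sum; apply: eq_bigr => k _.
  rewrite hornerM -rmorphXn hornerC coef_poly ltn_ord (horner_coef_wide _ (size_poly _ _)).
  rewrite mulr_suml; apply: eq_bigr => l _.
  rewrite coef_rVpoly_ord !mxE inord_val mxvecE mxE /=; ring.
Qed.

Definition grid_disagreement (F : finFieldType) (A B : F -> {poly F}) (I J : {set F}) : nat :=
  (\sum_(x in I) \sum_(y in J) ((A x).[y] != (B y).[x]))%N.

Lemma grid_disagreementC (F : finFieldType) (A B : F -> {poly F}) (I J : {set F}) :
  grid_disagreement A B I J = grid_disagreement B A J I.
Proof.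
rewrite /grid_disagreement exchange_big /=; apply: eq_bigr => y _.
by apply: eq_bigr => x _; rewrite eq_sym.
Qed.

(** Once [E] kills the disagreements, [E] times the rows and [E] times the columns agree at every
    grid point. They are therefore restrictions of one polynomial [P], to which
    [rational_interpolant_polynomial] applies. *)
Lemma bivariate_interpolant (F : finFieldType) (A B : F -> {poly F}) (I J : {set F}) d a N :
  (forall x, (size (A x) <= d.+1)%N) -> (forall y, (size (B y) <= d.+1)%N) ->
  (grid_disagreement A B I J < a.+1 * a.+1)%N ->
  (a + 2 * d < N)%N -> (N + a <= #|I|)%N -> (N + a <= #|J|)%N ->
  exists Q : {poly {poly F}},
    [/\ (size Q <= d.+1)%N, (sizeY Q <= d.+1)%N,
        (N <= #|[set x in I | Q.[x%:P] == A x]|)%N &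
        (N <= #|[set y in J | (swapXY Q).[y%:P] == B y]|)%N].
Proof.
move=> szA szB ltD ltN leI leJ.
pose L := [seq xy <- [seq (x, y) | x <- enum I, y <- enum J] |
            (A xy.1).[xy.2] != (B xy.2).[xy.1]].
have szL : size L = grid_disagreement A B I J.
  rewrite size_filter -sum1_count big_mkcond big_allpairs_dep /=.
  rewrite /grid_disagreement -big_enum /=; apply: eq_bigr => x _.
  by rewrite -big_enum /=; apply: eq_bigr => y _; case: ifP.
have inL x y : x \in I -> y \in J -> (A x).[y] != (B y).[x] -> (x, y) \in L.
  move=> xI yJ ne; rewrite mem_filter /= ne /=.
  by apply/allpairsP; exists (x, y); rewrite !mem_enum.
have [|E [E0 sE sYE EL]] := @vanishing_bidegree _ L a; first by rewrite szL.
have Exy x y : x \in I -> y \in J -> E.[x%:P].[y] * (A x).[y] = E.[x%:P].[y] * (B y).[x].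
  move=> xI yJ; case: (eqVneq (A x).[y] (B y).[x]) => [->//|ne].
  by rewrite (EL (x, y) (inL x y xI yJ ne)) !mul0r.
(* The products have degree at most a + d in each variable, so a + d + 1 rows determine [P]. These
   rows force the columns of [P], and the columns then force all its rows. *)
pose I1 := take (a + d).+1 (enum I).
have uI1 : uniq I1 by rewrite take_uniq ?enum_uniq.
have sI1 : size I1 = (a + d).+1.
  by rewrite size_takel // -cardE; move: leI ltN; lia.
have szM (p q : {poly F}) : (size p <= a.+1)%N -> (size q <= d.+1)%N -> (size (p * q)%R <= (a + d).+1)%N.
  move=> hp hq; apply: leq_trans (size_polyMleq _ _) _.
  by move: hp hq; move: (size p) (size q); lia.
have szEA x : (size (E.[x%:P] * A x)%R <= (a + d).+1)%N.
  by apply: szM => //; apply: leq_trans (max_size_evalC _ _) sYE.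
have szEB y : (size ((swapXY E).[y%:P] * B y)%R <= (a + d).+1)%N.
  by apply: szM => //; rewrite horner_swapXY; apply: leq_trans (size_poly _ _) sE.
have [|P [sP sYP eP]] := @interpolation_rows _ I1 (fun x => E.[x%:P] * A x) (a + d).+1 uI1.
  by move=> x _.
have I1I x : x \in I1 -> x \in I by move/mem_take; rewrite mem_enum.
have hJ y : y \in J -> (swapXY P).[y%:P] = (swapXY E).[y%:P] * B y.
  move=> yJ; apply: (poly_eq_on uI1); rewrite ?sI1 //.
    by rewrite horner_swapXY; apply: leq_trans (size_poly _ _) _; rewrite -sI1.
  move=> x xI1; rewrite horner2_swapXY eP // !hornerM horner2_swapXY.
  by apply: Exy => //; apply: I1I.
have hI x : x \in I -> P.[x%:P] = E.[x%:P] * A x.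
  move=> xI; apply: (@poly_eq_on _ _ _ (enum J)); rewrite ?enum_uniq // -?cardE.
  - apply: leq_trans (max_size_evalC _ _) (leq_trans sYP _).
    by apply: leq_trans leJ; move: ltN; lia.
  - by apply: leq_trans (szEA x) _; apply: leq_trans leJ; move: ltN; lia.
  move=> y; rewrite mem_enum => yJ; rewrite -horner2_swapXY hJ // !hornerM horner2_swapXY.
  by rewrite Exy.
have [||||||||||||Q [q1 q2 q3 q4]] := @rational_interpolant_polynomial F d a N A B E P (enum I) (enum J) szA szB.
- exact: enum_uniq.
- exact: enum_uniq.
- exact: E0.
- exact: sE.
- exact: sYE.
- exact: ltN.
- by apply: leq_trans sP _; rewrite sI1; move: ltN; lia.
- by apply: leq_trans sYP _; move: ltN; lia.
- rewrite -cardE; apply: leq_trans leI; rewrite leq_add2l.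
  by move: sE; move: (size E); lia.
- rewrite -cardE; apply: leq_trans leJ; rewrite leq_add2l.
  by move: sYE; move: (sizeY E); lia.
- by move=> x; rewrite mem_enum; apply: hI.
- by move=> y; rewrite mem_enum; apply: hJ.
exists Q; split=> //.
- apply: leq_trans q3 _; rewrite -size_filter cardE.
  apply: uniq_leq_size => [|x]; first exact/filter_uniq/enum_uniq.
  by rewrite mem_filter !mem_enum inE andbC.
- apply: leq_trans q4 _; rewrite -size_filter cardE.
  apply: uniq_leq_size => [|x]; first exact/filter_uniq/enum_uniq.
  by rewrite mem_filter !mem_enum inE andbC.
Qed.

Lemma card_poly_agree (F : finFieldType) (p q : {poly F}) d :
  (size p <= d.+1)%N -> (size q <= d.+1)%N -> p != q ->
  (#|[set x | p.[x] == q.[x]]| <= d)%N.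
Proof.
move=> sp sq pq; rewrite leqNgt; apply: contra pq => lt; apply/eqP.
apply: (@poly_eq_on _ _ _ (enum [set x | p.[x] == q.[x]])); rewrite ?enum_uniq // -?cardE.
- exact: leq_trans lt.
- exact: leq_trans lt.
- by move=> x; rewrite mem_enum inE => /eqP.
Qed.

(** On a bad column [Q] and [B y] agree at no more than [d] points, so at least [N - d] of the rows
    on which [Q] is right meet it in a disagreement. *)
Lemma bad_columns_bound (F : finFieldType) (A B : F -> {poly F}) (I J : {set F}) d N
    (Q : {poly {poly F}}) :
  (forall y, (size (B y) <= d.+1)%N) -> (size Q <= d.+1)%N ->
  (N <= #|[set x in I | Q.[x%:P] == A x]|)%N ->
  (#|[set y in J | (swapXY Q).[y%:P] != B y]| * (N - d) <= grid_disagreement A B I J)%N.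
Proof.
move=> szB sQ leN; rewrite grid_disagreementC /grid_disagreement -sum_nat_const.
rewrite [leqRHS](bigID (fun y => (swapXY Q).[y%:P] != B y)) /=.
apply: leq_trans (leq_addr _ _).
rewrite (eq_bigl (fun y => (y \in J) && ((swapXY Q).[y%:P] != B y))); last by move=> y; rewrite inE.
apply: leq_sum => y /andP[yJ ne].
have ag : (#|[set x | (swapXY Q).[y%:P].[x] == (B y).[x]]| <= d)%N.
  by apply: card_poly_agree => //; rewrite horner_swapXY; apply: leq_trans (size_poly _ _) sQ.
rewrite -big_mkcondr sum1_card leq_subLR.
apply: leq_trans leN _; apply: leq_trans (leq_add ag (leqnn _)).
rewrite -[X in (_ + X)%N]cardsE; apply: leq_trans (leq_of_leqif (leq_card_setU _ _)); apply: subset_leq_card.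
apply/subsetP => x; rewrite !inE => /andP[xI /eqP e]; rewrite [X in _ || X]unfold_in /= xI /=.
by rewrite horner2_swapXY e eq_sym orbN.
Qed.

Lemma bivariate_low_degree (F : finFieldType) (A B : F -> {poly F}) (I J : {set F}) d :
  (forall x, (size (A x) <= d.+1)%N) -> (forall y, (size (B y) <= d.+1)%N) ->
  (0 < d)%N -> (1000 * d < #|F|)%N -> (#|F| <= #|I|.+1)%N -> (#|F| <= #|J|.+1)%N ->
  (41 * grid_disagreement A B I J < 10 * #|F| ^ 2)%N ->
  exists Q : {poly {poly F}},
    [/\ (size Q <= d.+1)%N, (sizeY Q <= d.+1)%N,
        (#|F| * #|[set x in I | Q.[x%:P] != A x]| <= 2 * grid_disagreement A B I J)%N &
        (#|F| * #|[set y in J | (swapXY Q).[y%:P] != B y]| <= 2 * grid_disagreement A B I J)%N].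
Proof.
move=> szA szB d0 ltq leI leJ ltD; set q := #|F| in ltq leI leJ ltD *.
(* Nearly the largest [a] allowed with [N = q - 1 - a], as [a + 2 * d < N] is required. Then a + 1
   >= 45 q / 91, and (45/91)^2 exceeds 10/41. *)
pose a := (q - 2 - 2 * d)./2.
have a1 : (2 * a <= q - 2 - 2 * d)%N by rewrite /a; lia.
have a2 : (q - 2 - 2 * d <= 2 * a + 1)%N by rewrite /a; lia.
have ltDa : (grid_disagreement A B I J < a.+1 * a.+1)%N.
  have h : (45 * q <= 91 * a.+1)%N by move: ltq d0 a2; lia.
  have h2 : (45 * q * (45 * q) <= 91 * a.+1 * (91 * a.+1))%N by apply: leq_mul.
  by move: ltD h2; rewrite -mulnn (mulnACA 45) (mulnACA 91); move: (q * q)%N (a.+1 * a.+1)%N; lia.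
have [|||Q [q1 q2 q3 q4]] := @bivariate_interpolant F A B I J d a (q - 1 - a) szA szB ltDa.
- by move: ltq d0 a1; lia.
- by move: leI ltq d0 a1; lia.
- by move: leJ ltq d0 a1; lia.
have h : (q <= 2 * (q - 1 - a - d))%N by move: ltq d0 a1; lia.
exists Q; split=> //.
- have := @bad_columns_bound F B A J I d (q - 1 - a) (swapXY Q) szA.
  rewrite -sizeYE -grid_disagreementC swapXYK => /(_ q2 q4).
  by move=> le; apply: leq_trans (leq_mul h (leqnn _)) _; rewrite -mulnA leq_mul2l mulnC.
- have := bad_columns_bound J szB q1 q3.
  by move=> le; apply: leq_trans (leq_mul h (leqnn _)) _; rewrite -mulnA leq_mul2l mulnC.
Qed.

(** * Degree on lines and total degree *)

Lemma poly_eq_fun (F : finFieldType) (p q : {poly F}) :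
  (size p <= #|F|)%N -> (size q <= #|F|)%N -> (forall x, p.[x] = q.[x]) -> p = q.
Proof.
move=> sp sq e; apply: (@poly_eq_on _ _ _ (enum F)); rewrite ?enum_uniq -?cardE //.
Qed.

(** Axis-parallel lines give bidegree (d, d). On a line through the origin the degree is at most 2 d
    < q, so coefficients can be compared there: each homogeneous part of degree above [d] vanishes
    at all (1, b). *)
Lemma bivariate_total_degree (F : finFieldType) d (G : F -> F -> F) :
  (2 * d < #|F|)%N ->
  (forall a1 a2 u1 u2, exists2 p : {poly F}, (size p <= d.+1)%N &
     forall r, G (a1 + r * u1) (a2 + r * u2) = p.[r]) ->
  exists2 A : nat -> {poly F}, (forall e, (size (A e) <= d.+1 - e)%N) &
    forall s t, G s t = \sum_(e < d.+1) (A e).[s] * t ^+ e.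
Proof.
move=> ltq hG.
have /fin_all_exists[v hv] s : exists p : {poly F}, (size p <= d.+1)%N /\ forall t, G s t = p.[t].
  have [p sp ep] := hG s 0 0 1; exists p; split=> // t.
  by rewrite -ep mulr0 addr0 add0r mulr1.
have /fin_all_exists[w hw] t : exists p : {poly F}, (size p <= d.+1)%N /\ forall s, G s t = p.[s].
  have [p sp ep] := hG 0 t 1 0; exists p; split=> // s.
  by rewrite -ep mulr0 addr0 add0r mulr1.
pose S1 := take d.+1 (enum F).
have uS1 : uniq S1 by rewrite take_uniq ?enum_uniq.
have sS1 : size S1 = d.+1 by rewrite size_takel // -cardE; apply: leq_trans ltq; lia.
have [|Q [sQ sYQ eQ]] := @interpolation_rows _ S1 v d.+1 uS1.
  by move=> s _; case: (hv s).
rewrite sS1 in sQ.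
have colQ t : (swapXY Q).[t%:P] = w t.
  apply: (poly_eq_on uS1); rewrite ?sS1.
  - by rewrite horner_swapXY; apply: leq_trans (size_poly _ _) sQ.
  - by case: (hw t).
  - by move=> s sS; rewrite horner2_swapXY eQ // -(hv s).2 (hw t).2.
have GQ s t : G s t = Q.[s, t] by rewrite (hw t).2 -colQ horner2_swapXY.
have Q2 s t : Q.[s, t] = \sum_(k < d.+1) \sum_(e < d.+1) Q`_k`_e * t ^+ e * s ^+ k.
  rewrite (horner_coef_wide _ sQ) horner_sum; apply: eq_bigr => k _.
  rewrite hornerM -rmorphXn hornerC (horner_coef_wide _ (leq_trans (max_size_coefXY _ _) sYQ)).
  by rewrite mulr_suml.
have Qvan k e : (d < k + e)%N -> Q`_k`_e = 0.
  move=> lt.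
  case: (ltnP k d.+1) => [lk|lk]; last by rewrite (nth_default _ (leq_trans sQ lk)) coef0.
  case: (ltnP e d.+1) => [le|le]; last first.
    by rewrite nth_default // (leq_trans (leq_trans (max_size_coefXY _ _) sYQ) le).
  (* The homogeneous part of [Q] of degree [k + e], at (1, X). *)
  pose U := \sum_(k' < d.+1) \sum_(e' < d.+1)
              (Q`_k'`_e' *+ (k' + e' == k + e)%N) *: 'X^e' : {poly F}.
  have sU : (size U <= #|F|)%N.
    apply: leq_trans (_ : d.+1 <= _)%N; last by move: ltq; lia.
    apply: leq_trans (size_sum _ _ _) _; apply/bigmax_leqP => k' _.
    apply: leq_trans (size_sum _ _ _) _; apply/bigmax_leqP => e' _.
    by apply: leq_trans (size_scale_leq _ _) _; rewrite size_polyXn.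
  have U0 : U = 0.
    apply: poly_eq_fun; rewrite ?size_poly0 // => b; rewrite horner0.
    have [p sp ep] := hG 0 0 1 b.
    (* The restriction of [Q] to the line r -> (r, r b). *)
    pose H := \sum_(k' < d.+1) \sum_(e' < d.+1) (Q`_k'`_e' * b ^+ e') *: 'X^(k' + e') : {poly F}.
    have HP : H = p.
      apply: poly_eq_fun.
      - apply: leq_trans (_ : (2 * d).+1 <= _)%N => //.
        apply: leq_trans (size_sum _ _ _) _; apply/bigmax_leqP => k' _.
        apply: leq_trans (size_sum _ _ _) _; apply/bigmax_leqP => e' _.
        apply: leq_trans (size_scale_leq _ _) _; rewrite size_polyXn.
        by have := ltn_ord k'; have := ltn_ord e'; lia.
      - by apply: leq_trans sp _; move: ltq; lia.
      move=> r; rewrite -ep !add0r mulr1 GQ Q2 horner_sum; apply: eq_bigr => k' _.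
      rewrite horner_sum; apply: eq_bigr => e' _.
      by rewrite hornerZ hornerXn exprD exprMn; ring.
    have : H`_(k + e) = 0 by rewrite HP nth_default // (leq_trans sp).
    move=> <-; rewrite horner_sum coef_sum; apply: eq_bigr => k' _.
    rewrite horner_sum coef_sum; apply: eq_bigr => e' _.
    rewrite hornerZ hornerXn coefZ coefXn eq_sym mulrnAl; case: eqP => _ /=.
      by rewrite mulr1n mulr1.
    by rewrite mulr0n mulr0.
  have : U`_e = 0 by rewrite U0 coef0.
  rewrite coef_sum (bigD1 (Ordinal lk)) //= [X in _ + X]big1 ?addr0; last first.
    move=> k' nk; rewrite coef_sum big1 // => e' _; rewrite coefZ coefXn.
    case: eqP => [ek|_]; last by rewrite mulr0n mul0r.
    case: eqP => [ee|_]; last by rewrite mulr0.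
    by case/eqP: nk; apply: val_inj => /=; move: ek; rewrite ee; lia.
  rewrite coef_sum (bigD1 (Ordinal le)) //= [X in _ + X]big1 ?addr0; last first.
    move=> e' ne; rewrite coefZ coefXn.
    case: eqP => [ek|_]; last by rewrite mulr0n mul0r.
    by case/eqP: ne; apply: val_inj => /=; move: ek; lia.
  by rewrite coefZ coefXn !eqxx mulr1n mulr1.
exists (fun e => (swapXY Q)`_e) => [e|s t].
  by apply/leq_sizeP => k lek; rewrite coef_swapXY Qvan //; move: lek; lia.
rewrite GQ -horner2_swapXY (@horner_coef_wide _ d.+1 (swapXY Q)) -?sizeYE // horner_sum.
by apply: eq_bigr => e _; rewrite hornerM -rmorphXn hornerC.
Qed.

Definition line_degree (F : finFieldType) (m d : nat) (g : 'rV[F]_m -> F) : Prop :=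
  forall a u, exists2 p : {poly F}, (size p <= d.+1)%N & forall t, g (a + t *: u) = p.[t].

(** Induction on the number of coordinates that matter: expand [g] in powers of the last one. By the
    planar case the coefficient of its e-th power has degree at most [d - e] on lines, and it
    depends on one coordinate fewer. *)
Lemma line_degree_polynomial_dep (F : finFieldType) (m k : nat) :
  forall d (g : 'rV[F]_m -> F), (2 * d < #|F|)%N -> line_degree d g ->
  (forall a b : 'rV[F]_m, (forall i : 'I_m, (i < k)%N -> a 0 i = b 0 i) -> g a = g b) ->
  exists2 Q : {mpoly F[m]}, (msize Q <= d.+1)%N & forall a, g a = mpeval Q a.
Proof.
elim: k => [|k IHk] d g ltq hg dep.
  exists ((g 0)%:MP) => [|a]; first by rewrite mmeasureC; case: (_ != _).
  by rewrite /mpeval mevalC; apply: dep.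
case: (ltnP k m) => [ltk|lek]; last first.
  apply: IHk => // a b ab; apply: dep => i _; apply: ab.
  exact: leq_trans (ltn_ord i) lek.
pose i0 := Ordinal ltk; pose e0 : 'rV[F]_m := delta_mx 0 i0.
(* [z] sets the coordinate [i0] to zero. *)
pose z (a : 'rV[F]_m) := a - a 0 i0 *: e0.
have zD a s u : z (a + s *: u) = z a + s *: z u.
  by rewrite /z !mxE scalerBr scalerDl scalerA opprD; rewrite addrACA.
have /fin_all_exists[pa hpa] a : exists p : {poly F},
    (size p <= d.+1)%N /\ forall t, g (z a + t *: e0) = p.[t].
  by have [p sp ep] := hg (z a) e0; exists p.
have szq a : (size (pa a) <= #|F|)%N by apply: leq_trans (hpa a).1 _; move: ltq; lia.
have /fin_all_exists[Q hQ] (e : 'I_d.+1) : exists Q : {mpoly F[m]},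
    (msize Q <= (d - e).+1)%N /\ forall a, (pa a)`_e = mpeval Q a.
  have [||a b ab|Q sQ eQ] := IHk (d - e)%N (fun a => (pa a)`_e).
  - by move: ltq; lia.
  - move=> a u.
    have [|A sA eA] := @bivariate_total_degree F d (fun s t => g (z (a + s *: u) + t *: e0)) ltq.
      move=> a1 a2 u1 u2.
      have [p sp ep] := hg (z a + a1 *: z u + a2 *: e0) (u1 *: z u + u2 *: e0).
      exists p => // r; rewrite -ep; congr g; rewrite zD.
      move: (z a) (z u) => za zu.
      by rewrite !scalerDl !scalerDr !scalerA -!addrA [_ *: e0 + (_ + _)]addrCA.
    exists (A e) => [|t]; first by apply: leq_trans (sA e) _; rewrite subSn // -ltnS.
    have -> : pa (a + t *: u) = \poly_(e' < d.+1) (A e').[t].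
      apply: poly_eq_fun => //; first by apply: leq_trans (size_poly _ _) _; move: ltq; lia.
      by move=> r; rewrite -(hpa _).2 eA horner_poly.
    by rewrite coef_poly ltn_ord.
  - suff -> : pa a = pa b by [].
    apply: poly_eq_fun => // t; rewrite -!(hpa _).2; apply: dep => i lti.
    rewrite !mxE eqxx /=; case: (eqVneq i i0) => [->|ne] /=.
      by rewrite !mulr1 !subrr.
    rewrite !mulr0 !subr0 ab //.
    by move: lti; rewrite ltnS leq_eqVlt => /orP[/eqP ei|//]; case/eqP: ne; apply: val_inj.
  by exists Q.
exists (\sum_e Q e * 'X_i0 ^+ e) => [|a].
  apply: leq_trans (mmeasure_sum _ _ _ _) _; apply/bigmax_leqP => e _.
  case: (eqVneq (Q e) 0) => [->|Qe0]; first by rewrite mul0r msize0.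
  have hX : msize ('X_i0 ^+ e : {mpoly F[m]}) = e.+1.
    by rewrite mpolyXn msizeX mdegMn mdeg1 mul1n.
  rewrite msizeM // -?msize_poly_eq0 ?hX //.
  have := (hQ e).1; move: (ltn_ord e); move: (msize _) (nat_of_ord e) => x y; lia.
have -> : g a = (pa a).[a 0 i0] by rewrite -(hpa a).2 /z subrK.
rewrite (horner_coef_wide _ (hpa a).1) /mpeval raddf_sum; apply: eq_bigr => e _.
by rewrite /= mevalM rmorphXn /= mevalXU (hQ e).2.
Qed.

Lemma line_degree_polynomial (F : finFieldType) (m d : nat) (g : 'rV[F]_m -> F) :
  (2 * d < #|F|)%N -> line_degree d g ->
  exists2 Q : {mpoly F[m]}, (msize Q <= d.+1)%N & forall a, g a = mpeval Q a.
Proof.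
move=> ltq hg; apply: (@line_degree_polynomial_dep F m m) => // a b ab.
by congr g; apply/rowP => i; apply: ab.
Qed.

(** * Self-correction *)

(* [Lam b u] is the line polynomial under the parametrization [t |-> b + t u]; [u = 0] is
   allowed, so that directions are uniform over the whole space. *)
Definition lines_family (F : finFieldType) (m d : nat) (Lam : 'rV[F]_m -> 'rV[F]_m -> {poly F}) : Prop :=
  (forall b u, (size (Lam b u) <= d.+1)%N) /\
  (forall b u s t, (Lam (b + s *: u) u).[t] = (Lam b u).[t + s]).

(** Above (q + d) / 2 agreements the polynomial is unique: two of them would coincide at more than
    [d] points. *)
Definition majority_closed (F : finFieldType) (m d : nat) (f : 'rV[F]_m -> F)
    (Lam : 'rV[F]_m -> 'rV[F]_m -> {poly F}) : Prop :=
  forall b u (p : {poly F}), (size p <= d.+1)%N ->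
    (#|F| + d < 2 * #|[set t | f (b + t *: u)%R == p.[t]%R]|)%N -> Lam b u = p.

Definition family_err (F : finFieldType) (m : nat) (f : 'rV[F]_m -> F)
    (Lam : 'rV[F]_m -> 'rV[F]_m -> {poly F}) : nat :=
  (\sum_b \sum_u (f b != (Lam b u).[0]))%N.

(* The base point [t = 0] is left out: for a given [x] nothing is known about [f x]. *)
Definition line_dist (F : finFieldType) (m : nat) (f : 'rV[F]_m -> F)
    (Lam : 'rV[F]_m -> 'rV[F]_m -> {poly F}) x k : nat :=
  (\sum_(t in [set~ 0%R]) (f (x + t *: k)%R != (Lam x k).[t]))%N.

(** * Averaging identities *)

Lemma sum_translate (F : finFieldType) (m : nat) (x : 'rV[F]_m) (phi : 'rV[F]_m -> nat) :
  (\sum_h phi (h + x)%R = \sum_h phi h)%N.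
Proof. by rewrite [RHS](reindex_inj (addIr x)). Qed.

Lemma sum_affine (F : finFieldType) (m : nat) (x : 'rV[F]_m) (i : F) (phi : 'rV[F]_m -> nat) :
  i != 0 -> (\sum_h phi (x + i *: h)%R = \sum_h phi h)%N.
Proof.
move=> i0; rewrite [RHS](reindex_inj (h := fun h => x + i *: h)) //.
by move=> a b /addrI; apply: scalerI.
Qed.

Lemma neq_split (T : eqType) (a b c : T) : ((b != c) <= (a != b) + (a != c))%N.
Proof. by case: (eqVneq a b) => [->|_] //=; case: (b != c). Qed.

Lemma sum_lt_exists (T : finType) (phi : T -> nat) c :
  (\sum_t phi t < c * #|T|)%N -> exists t, (phi t < c)%N.
Proof.
move=> lt; apply/existsP; move: lt; apply: contraTT; rewrite negb_exists => /forallP ge.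
rewrite -leqNgt mulnC -sum_nat_const; apply: leq_sum => t _.
by rewrite leqNgt.
Qed.

Lemma cardsC1_succ (F : finFieldType) : #|[set~ (0 : F)]|.+1 = #|F|.
Proof. by rewrite cardsC1 prednK //; apply/card_gt0P; exists 0. Qed.

(** For fixed [u], translating [b] by [t *: u] turns the test at parameter [t] into the test at
    0. *)
Lemma family_err_shift (F : finFieldType) (m d : nat) (f : 'rV[F]_m -> F) Lam (t : F) :
  lines_family d Lam ->
  (\sum_b \sum_u (f (b + t *: u)%R != (Lam b u).[t]) = family_err f Lam)%N.
Proof.
move=> [_ inv]; rewrite /family_err exchange_big [RHS]exchange_big /=.
apply: eq_bigr => u _; rewrite -[RHS](sum_translate (t *: u)).
by apply: eq_bigr => b _; rewrite inv add0r.
Qed.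

Lemma eq_leq2 (a b a' b' : nat) : a = a' -> b = b' -> (a <= b)%N -> (a' <= b')%N.
Proof. by move=> -> ->. Qed.

Lemma sum_const_all (T : finType) (c : nat) : (\sum_(t : T) c = #|T| * c)%N.
Proof. by rewrite big_const iter_addn_0 mulnC. Qed.

(** Where [f x != g x], each direction whose line takes the value [g x] at [x] is an error, and at
    least 87% of the directions are of this kind. *)
Lemma family_err_center (F : finFieldType) (m : nat) (f g : 'rV[F]_m -> F) Lam :
  (forall x, (100 * \sum_h ((Lam x h).[0] != g x) <= 13 * #|'rV[F]_m|)%N) ->
  (87 * (#|'rV[F]_m| * #|[set x | f x != g x]|) <= 100 * family_err f Lam)%N.
Proof.
move=> gP.
rewrite -sum1_card big_distrr /= big_distrr /= /family_err big_distrr /=.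
rewrite [leqRHS](bigID (fun x => f x != g x)) /=; apply: leq_trans (leq_addr _ _).
rewrite (eq_bigl (fun x => f x != g x)); last by move=> x; rewrite inE.
apply: leq_sum => x ne; rewrite muln1.
have : (#|'rV[F]_m| <= \sum_u (f x != (Lam x u).[0]) + \sum_h ((Lam x h).[0] != g x))%N.
  rewrite -big_split /= -[leqLHS]muln1 -sum_const_all; apply: leq_sum => u _.
  by have := neq_split (Lam x u).[0] (f x) (g x); rewrite ne eq_sym.
by have := gP x; move: (\sum_h _)%N (\sum_u _)%N #|'rV[F]_m| => u v w; lia.
Qed.

Section Family.
Variables (F : finFieldType) (m d : nat) (f : 'rV[F]_m -> F).
Variable Lam : 'rV[F]_m -> 'rV[F]_m -> {poly F}.
Hypotheses (d0 : (0 < d)%N) (ltq : (1000 * d < #|F|)%N).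
Hypotheses (fam : lines_family d Lam) (maj : majority_closed d f Lam).
Hypothesis err_small : (100 * family_err f Lam <= #|'rV[F]_m| ^ 2)%N.

Local Notation V := 'rV[F]_m.
Local Notation q := #|F|.
Local Notation N := #|'rV[F]_m|.
Local Notation err := (family_err f Lam).
Local Notation Fx := [set~ (0 : F)].

Let szL b u : (size (Lam b u) <= d.+1)%N. Proof. by case: fam. Qed.
Let N0 : (0 < N)%N. Proof. by apply/card_gt0P; exists 0. Qed.

(** The line [z + j k] plays row [i] of the grid. Outside the [b] bad columns and the [Y] points
    where [f] differs from its column, [f] follows row [i] of [Q], which is then a majority
    polynomial. *)
Lemma edge_recovered (Q : {poly {poly F}}) (B : F -> {poly F}) (z k : V) (i : F) :
  (sizeY Q <= d.+1)%N ->
  let b := #|[set y in Fx | (swapXY Q).[y%:P]%R != B y]| in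
  let Y := (\sum_(j in Fx) (f (z + j *: k)%R != (B j).[i]))%N in
  (41 * (b + Y) < 20 * q)%N ->
  Lam z k = Q.[i%:P] /\ (line_dist f Lam z k <= b + Y)%N.
Proof.
move=> sYQ b Y lt.
pose bad := [set j in Fx | f (z + j *: k) != Q.[i%:P].[j]].
have lebad : (#|bad| <= b + Y)%N.
  have -> : Y = #|[set j in Fx | f (z + j *: k)%R != (B j).[i]%R]|.
    rewrite /Y -big_mkcondr sum1_card -cardsE; apply: eq_card => j.
    by rewrite !inE [RHS]inE unfold_in /= !inE.
  apply: leq_trans (leq_of_leqif (leq_card_setU _ _)); apply: subset_leq_card.
  apply/subsetP => j; rewrite !inE => /andP[j0 ne]; rewrite j0 /=.
  case: eqP => //= e; apply: contra ne => /eqP->.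
  by rewrite -e horner2_swapXY.
have LQ : Lam z k = Q.[i%:P].
  apply: maj; first exact: leq_trans (max_size_evalC _ _) sYQ.
  have : (q <= #|[set t | f (z + t *: k)%R == Q.[i%:P].[t]%R]| + (#|bad| + #|[set (0%R : F)]|))%N.
    rewrite -cardsT.
    apply: leq_trans (leq_add (leqnn _) (leq_of_leqif (leq_card_setU _ _))).
    apply: leq_trans (leq_of_leqif (leq_card_setU _ _)); apply: subset_leq_card.
    apply/subsetP => t _; rewrite !inE.
    by case: eqP => //= _; rewrite andbT orNb.
  (* Besides [b + Y] the parameter 0 counts as lost; the slack q / 41 left by 20 / 41 covers it
     together with [d]. *)
  rewrite cards1; move: lebad lt ltq d0; move: #|bad| #|[set t | _]| (b + Y)%N q; lia.
split=> //; rewrite /line_dist LQ; apply: leq_trans lebad.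
rewrite -big_mkcondr sum1_card -cardsE; apply/eq_leq/eq_card => j.
by rewrite !inE [RHS]inE unfold_in /= !inE.
Qed.

(* The row [i] of the surface [x + i h1 + j h2 + i j h3], as a polynomial in [j];
   exchanging [h1] and [h2] gives the columns. *)
Definition surf (x h1 h2 h3 : V) (i : F) := Lam (x + i *: h1) (h2 + i *: h3).

Definition surf_dis (x h1 h2 h3 : V) :=
  grid_disagreement (surf x h1 h2 h3) (surf x h2 h1 h3) Fx Fx.

(** The edge through [x] in direction [k], tested against the lines of the surface that cross it. *)
Definition edge_err (x k l h3 : V) : nat :=
  (\sum_(j in Fx) (f (x + j *: k)%R != (surf x k l h3 j).[0]))%N.

(** For [i != 0] the base [x + i *: h1] and the direction [h2 + i *: h3] are independent and
    uniform. *)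
Lemma surf_sum x t i : i != 0 ->
  (\sum_h1 \sum_h2 \sum_h3 (f (x + i *: h1 + t *: (h2 + i *: h3))%R
     != (surf x h1 h2 h3 i).[t]) = N * err)%N.
Proof.
move=> i0; rewrite exchange_big /= -sum_nat_const; apply: eq_bigr => h2 _.
pose phi b u := ((f (b + t *: u) != (Lam b u).[t]) : nat).
transitivity (\sum_h1 \sum_u phi (x + i *: h1)%R u)%N.
  by apply: eq_bigr => h1 _; exact: (sum_affine h2 (phi (x + i *: h1)) i0).
rewrite (sum_affine x (fun b => \sum_u phi b u)%N i0); exact: (family_err_shift f t fam).
Qed.

Lemma edge_sum x : (\sum_k \sum_l \sum_h3 edge_err x k l h3 = #|Fx| * (N * err))%N.
Proof.
rewrite -sum_nat_const; under eq_bigr do under eq_bigr do rewrite exchange_big /=.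
under eq_bigr do rewrite exchange_big /=; rewrite exchange_big /=.
apply: eq_bigr => j; rewrite !inE => j0; rewrite -(surf_sum x 0 j0).
apply: eq_bigr => k _; apply: eq_bigr => l _; apply: eq_bigr => h3 _.
by rewrite scale0r addr0.
Qed.

(** A row and a column that disagree at a grid point cannot both agree with [f] there; each kind
    contributes the same total. *)
Lemma surf_dis_sum x :
  (\sum_h1 \sum_h2 \sum_h3 surf_dis x h1 h2 h3 <= 2 * (#|Fx| * (#|Fx| * (N * err))))%N.
Proof.
pose e1 h1 h2 h3 i j := ((f (x + i *: h1 + j *: (h2 + i *: h3)) != (surf x h1 h2 h3 i).[j]) : nat).
have le h1 h2 h3 : (surf_dis x h1 h2 h3 <=
    \sum_(i in Fx) \sum_(j in Fx) e1 h1 h2 h3 i j + \sum_(j in Fx) \sum_(i in Fx) e1 h2 h1 h3 j i)%N.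
  rewrite [X in (_ + X)%N]exchange_big -big_split /=; apply: leq_sum => i _.
  rewrite -big_split /=; apply: leq_sum => j _; rewrite /e1.
  have -> : x + j *: h2 + i *: (h1 + j *: h3) = x + i *: h1 + j *: (h2 + i *: h3).
    by rewrite !scalerDr !scalerA [j * i]mulrC !addrA [x + _ + _]addrAC.
  exact: neq_split.
have tot : (\sum_h1 \sum_h2 \sum_h3 \sum_(i in Fx) \sum_(j in Fx) e1 h1 h2 h3 i j
             = #|Fx| * (#|Fx| * (N * err)))%N.
  rewrite -!sum_nat_const; under eq_bigr do under eq_bigr do rewrite exchange_big /=.
  under eq_bigr do rewrite exchange_big /=; rewrite exchange_big /=.
  apply: eq_bigr => i; rewrite !inE => i0.
  under eq_bigr do under eq_bigr do rewrite exchange_big /=.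
  under eq_bigr do rewrite exchange_big /=; rewrite exchange_big /=.
  by apply: eq_bigr => j _; rewrite sum_nat_const -(surf_sum x j i0).
apply: leq_trans (_ : _ <= \sum_h1 \sum_h2 \sum_h3
   (\sum_(i in Fx) \sum_(j in Fx) e1 h1 h2 h3 i j + \sum_(j in Fx) \sum_(i in Fx) e1 h2 h1 h3 j i))%N _.
  by apply: leq_sum => h1 _; apply: leq_sum => h2 _; apply: leq_sum => h3 _; apply: le.
under eq_bigr do under eq_bigr do rewrite big_split /=.
under eq_bigr do rewrite big_split /=; rewrite big_split /=.
by rewrite tot [X in (_ + X)%N]exchange_big /= tot mul2n addnn.
Qed.

(** Multiplied by [n], the conclusion follows from 82 D + 41 n Y < 20 n^2, which twice the last
    hypothesis implies. *)
Lemma threshold_arith (n b D Y : nat) :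
  (0 < n -> n * b <= 2 * D -> 43 * D + 21 * (n * Y) < 10 * n ^ 2 -> 41 * (b + Y) < 20 * n)%N.
Proof.
move=> n0 le lt; rewrite -(ltn_pmul2l n0) mulnCA mulnDr [(n * (20 * n))%N]mulnCA.
by move: le lt; rewrite -mulnn; move: (n * b)%N (n * Y)%N (n * n)%N => u v w; lia.
Qed.

Let q0 : (0 < q)%N. Proof. by move: ltq; lia. Qed.

(** The grid omits row 0 and column 0, as they pass through the fixed [x]. Each is recovered from
    [Q] by [edge_recovered] under a condition on its own edge only. *)
Lemma surf_recovered x h1 h2 h3 :
  (43 * surf_dis x h1 h2 h3 + 21 * (q * edge_err x h2 h1 h3) < 10 * q ^ 2)%N ->
  exists Q : {poly {poly F}},
    [/\ Lam x h2 = Q.[0%:P],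
        (q * line_dist f Lam x h2 <= 2 * surf_dis x h1 h2 h3 + q * edge_err x h2 h1 h3)%N &
        (43 * surf_dis x h1 h2 h3 + 21 * (q * edge_err x h1 h2 h3) < 10 * q ^ 2)%N ->
          Lam x h1 = (swapXY Q).[0%:P]].
Proof.
move=> lt.
have [|||||||Q [sQ sYQ bR bC]] :=
  @bivariate_low_degree F (surf x h1 h2 h3) (surf x h2 h1 h3) Fx Fx d.
- by move=> i; apply: szL.
- by move=> i; apply: szL.
- exact: d0.
- exact: ltq.
- by rewrite cardsC1_succ.
- by rewrite cardsC1_succ.
- by move: lt; rewrite -/(surf_dis x h1 h2 h3); lia.
have [|e1 e2] := @edge_recovered Q (surf x h2 h1 h3) x h2 0 sYQ.
  exact: threshold_arith q0 bC lt.
exists Q; split=> //.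
  apply: leq_trans (leq_mul (leqnn q) e2) _; rewrite mulnDr leq_add //.
move=> lt'.
have := @edge_recovered (swapXY Q) (surf x h1 h2 h3) x h1 0.
rewrite sizeYE swapXYK => /(_ sQ) []//.
exact: threshold_arith q0 bR lt'.
Qed.

(** Markov's inequality in pointwise form: when the right side reaches 10 q^2 the trivial bound [q]
    on the distance suffices. *)
Lemma line_dist_surf x h1 h2 h3 :
  (10 * (q * line_dist f Lam x h2) <= 43 * surf_dis x h1 h2 h3 + 21 * (q * edge_err x h2 h1 h3))%N.
Proof.
case: (ltnP (43 * surf_dis x h1 h2 h3 + 21 * (q * edge_err x h2 h1 h3)) (10 * q ^ 2)) => [lt|ge].
  have [Q [_ le _]] := surf_recovered lt.
  by move: le; move: (q * _)%N (q * _)%N (surf_dis _ _ _ _) => u v w; lia.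
apply: leq_trans ge; rewrite leq_pmul2l // -mulnn leq_pmul2l //.
apply: leq_trans (_ : #|Fx| <= _)%N; last by rewrite -cardsC1_succ.
by rewrite -sum1_card; apply: leq_sum => t _; case: (_ != _).
Qed.

(** When both edges are recovered, both values are Q(0, 0). *)
Lemma center_disagree_surf x h1 h2 h3 :
  (10 * (((Lam x h1).[0] != (Lam x h2).[0]) * q ^ 2) <=
   43 * surf_dis x h1 h2 h3 + 21 * (q * edge_err x h2 h1 h3) + 21 * (q * edge_err x h1 h2 h3))%N.
Proof.
case: (ltnP (43 * surf_dis x h1 h2 h3 + 21 * (q * edge_err x h2 h1 h3)
              + 21 * (q * edge_err x h1 h2 h3)) (10 * q ^ 2)) => [lt|ge]; last first.
  by apply: leq_trans ge; rewrite leq_pmul2l //; case: (_ != _); rewrite ?mul1n.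
have [|Q [e1 _ e2]] := @surf_recovered x h1 h2 h3.
  by apply: leq_ltn_trans lt; apply: leq_addr.
rewrite e1 e2 ?horner2_swapXY ?eqxx //.
by apply: leq_ltn_trans lt; rewrite leq_add2r leq_addr.
Qed.

Let leFx : (#|Fx| <= q)%N. Proof. by rewrite -cardsC1_succ. Qed.

(** Averaging [line_dist_surf] gives (43 * 2 + 21) / 10 = 10.7 times an error rate of at most 1%,
    rounded up to 11%. *)
Lemma line_dist_sum x : (100 * \sum_k line_dist f Lam x k <= 11 * (q * N))%N.
Proof.
set S := (\sum_k _)%N.
have tot : (10 * (q * (N * (N * S))) <=
    43 * (2 * (#|Fx| * (#|Fx| * (N * err)))) + 21 * (q * (#|Fx| * (N * err))))%N.
  apply: leq_trans (_ : \sum_(h1 : V) \sum_(h2 : V) \sum_(h3 : V) 10 * (q * line_dist f Lam x h2) <= _)%N.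
    apply/eq_leq; under eq_bigr do under eq_bigr do rewrite (@sum_const_all V).
    rewrite (@sum_const_all V) -!big_distrr /= -/S; ring.
  apply: leq_trans (_ : \sum_h1 \sum_h2 \sum_h3
      (43 * surf_dis x h1 h2 h3 + 21 * (q * edge_err x h2 h1 h3)) <= _)%N.
    by do 3 (apply: leq_sum => ? _); apply: line_dist_surf.
  under eq_bigr do under eq_bigr do rewrite big_split -!big_distrr /=.
  under eq_bigr do rewrite big_split -!big_distrr /=; rewrite big_split -!big_distrr /=.
  rewrite [X in (_ + 21 * (q * X))%N]exchange_big /= edge_sum.
  by rewrite leq_add2r leq_pmul2l // surf_dis_sum.
have le2 : (10 * (q * (N * (N * S))) <= 107 * (q * (q * (N * err))))%N.
  apply: leq_trans tot _.
  have a1 : (#|Fx| * (#|Fx| * (N * err)) <= q * (q * (N * err)))%N by rewrite !leq_mul.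
  have a2 : (q * (#|Fx| * (N * err)) <= q * (q * (N * err)))%N by rewrite !leq_mul.
  move: a1 a2; move: (#|Fx| * (#|Fx| * _))%N (q * (#|Fx| * _))%N (q * (q * _))%N => u v w; lia.
have le3 : (10 * (N * S) <= 107 * (q * err))%N.
  rewrite -(leq_pmul2l (m := (q * N)%N)) ?muln_gt0 ?q0 //.
  by move: le2; apply: eq_leq2; ring.
have le4 : (N * (1000 * S) <= N * (107 * (q * N)))%N.
  apply: leq_trans (_ : 107 * (q * (100 * err)) <= _)%N.
    have : (100 * (10 * (N * S)) <= 100 * (107 * (q * err)))%N by rewrite leq_pmul2l.
    by apply: eq_leq2; ring.
  apply: leq_trans (_ : 107 * (q * N ^ 2) <= _)%N; first by rewrite leq_pmul2l // leq_pmul2l.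
  by apply: eq_leq; ring.
by move: le4; rewrite leq_pmul2l //; move: (q * N)%N => w; lia.
Qed.

(** Here the factor is (43 * 2 + 21 + 21) / 10 = 12.8, rounded up to 13%. *)
Lemma center_disagree_sum x :
  (100 * \sum_h1 \sum_h2 ((Lam x h1).[0] != (Lam x h2).[0]) <= 13 * N ^ 2)%N.
Proof.
set S := (\sum_h1 _)%N.
have tot : (10 * (N * (S * q ^ 2)) <=
    43 * (2 * (#|Fx| * (#|Fx| * (N * err)))) + 21 * (q * (#|Fx| * (N * err)))
      + 21 * (q * (#|Fx| * (N * err))))%N.
  apply: leq_trans (_ : \sum_(h1 : V) \sum_(h2 : V) \sum_(h3 : V)
      10 * (((Lam x h1).[0] != (Lam x h2).[0]) * q ^ 2) <= _)%N.
    apply/eq_leq; under eq_bigr do under eq_bigr do rewrite (@sum_const_all V).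
    under eq_bigr do rewrite -!big_distrr -big_distrl /=.
    by rewrite -!big_distrr -big_distrl /= -/S; ring.
  apply: leq_trans (_ : \sum_h1 \sum_h2 \sum_h3
      (43 * surf_dis x h1 h2 h3 + 21 * (q * edge_err x h2 h1 h3)
        + 21 * (q * edge_err x h1 h2 h3)) <= _)%N.
    by do 3 (apply: leq_sum => ? _); apply: center_disagree_surf.
  under eq_bigr do under eq_bigr do rewrite 2!big_split -!big_distrr /=.
  under eq_bigr do rewrite 2!big_split -!big_distrr /=.
  rewrite 2!big_split -!big_distrr /=.
  rewrite [X in (_ + 21 * (q * X) + _)%N]exchange_big /= !edge_sum.
  by rewrite !leq_add2r leq_pmul2l // surf_dis_sum.
have le2 : (10 * (N * (S * q ^ 2)) <= 128 * (q * (q * (N * err))))%N.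
  apply: leq_trans tot _.
  have a1 : (#|Fx| * (#|Fx| * (N * err)) <= q * (q * (N * err)))%N by rewrite !leq_mul.
  have a2 : (q * (#|Fx| * (N * err)) <= q * (q * (N * err)))%N by rewrite !leq_mul.
  move: a1 a2; move: (#|Fx| * (#|Fx| * _))%N (q * (#|Fx| * _))%N (q * (q * _))%N => u v w; lia.
have le3 : (10 * S <= 128 * err)%N.
  rewrite -(leq_pmul2l (m := (q * q * N)%N)) ?muln_gt0 ?q0 //.
  by move: le2; apply: eq_leq2; ring.
by move: le3 err_small; lia.
Qed.

(** Some direction [h0] disagrees with the others no more than average; its value at [x] is
    taken. *)
Lemma center_exists x : exists c, (100 * \sum_h ((Lam x h).[0] != c) <= 13 * N)%N.
Proof.
have [|h0 lt] := @sum_lt_exists V (fun h1 => 100 * \sum_h2 ((Lam x h1).[0] != (Lam x h2).[0]))%N (13 * N).+1.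
  rewrite -big_distrr /=; apply: leq_ltn_trans (center_disagree_sum x) _.
  by rewrite -mulnn (mulSn (13 * N)) -mulnA -[ltnLHS]add0n ltn_add2r.
exists (Lam x h0).[0]; rewrite -ltnS; apply: leq_ltn_trans lt; rewrite leq_pmul2l //.
by apply: leq_sum => h _; rewrite eq_sym.
Qed.

(** * The corrected function on lines *)

Variable g : V -> F.
Hypothesis gP : forall x, (100 * \sum_h ((Lam x h).[0] != g x) <= 13 * N)%N.

(** Column 0 of the surface [x + i h + j (h1 + i h2)] is the given line, and row [i] passes through
    its point [x + i h]. So Q(., 0) follows the values [g] there, for most [i] and certainly at the
    prescribed [i0]. *)
Lemma line_points_surface x h i0 :
  exists p : {poly F}, [/\ (size p <= d.+1)%N, g (x + i0 *: h) = p.[i0] &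
    (41 * #|[set i | g (x + i *: h)%R != p.[i]%R]| < 20 * q)%N].
Proof.
pose A (h1 h2 : V) (i : F) := Lam (x + i *: h) (h1 + i *: h2).
pose B (h1 h2 : V) (j : F) := Lam (x + j *: h1) (h + j *: h2).
pose D h1 h2 := grid_disagreement (A h1 h2) (B h1 h2) setT Fx.
pose p_ (h1 h2 : V) (i j : F) := x + i *: h + j *: (h1 + i *: h2).
have pE h1 h2 i j : p_ h1 h2 i j = x + j *: h1 + i *: (h + j *: h2).
  by rewrite /p_ !scalerDr !scalerA [j * i]mulrC !addrA [x + _ + _]addrAC.
pose Z h1 h2 := (\sum_i ((A h1 h2 i).[0] != g (x + i *: h)%R))%N.
pose y h1 h2 i := (\sum_(j in Fx) (f (p_ h1 h2 i j) != (B h1 h2 j).[i]))%N.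
pose z h1 h2 := ((A h1 h2 i0).[0] != g (x + i0 *: h) : nat).
have sumZ1 i : (100 * \sum_h1 \sum_h2 ((A h1 h2 i).[0] != g (x + i *: h)%R) <= 13 * (N * N))%N.
  rewrite exchange_big /= big_distrr /= mulnCA -sum_const_all; apply: leq_sum => h2 _.
  have := sum_translate (i *: h2) (fun k => (Lam (x + i *: h) k).[0] != g (x + i *: h) : nat).
  by move=> ->; apply: gP.
have sumZ : (100 * \sum_h1 \sum_h2 Z h1 h2 <= q * (13 * (N * N)))%N.
  under eq_bigr do rewrite exchange_big /=.
  by rewrite exchange_big /= big_distrr /= -sum_const_all; apply: leq_sum => i _; apply: sumZ1.
have sumy i : (\sum_h1 \sum_h2 y h1 h2 i = #|Fx| * err)%N.
  under eq_bigr do rewrite exchange_big /=.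
  rewrite exchange_big /= -sum_nat_const; apply: eq_bigr => j; rewrite !inE => j0.
  rewrite -(family_err_shift f i fam).
  rewrite -(sum_affine x (fun b => \sum_u (f (b + i *: u)%R != (Lam b u).[i]))%N j0).
  apply: eq_bigr => h1 _.
  rewrite -(sum_affine h (fun u => f (x + j *: h1 + i *: u) != (Lam (x + j *: h1) u).[i] : nat) j0).
  by apply: eq_bigr => h2 _; rewrite pE.
(* Rows pass through prescribed points and are compared with [f] by [line_dist_sum] (11%); columns
   with [j != 0] are uniform lines (1%). *)
have leD h1 h2 : (D h1 h2 <= \sum_i (line_dist f Lam (x + i *: h)%R (h1 + i *: h2)%R + y h1 h2 i))%N.
  rewrite /D /grid_disagreement (eq_bigl predT) /=; last by move=> i; rewrite inE.
  apply: leq_sum => i _; rewrite -big_split /=; apply: leq_sum => j _.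
  exact: neq_split.
have sumD : (100 * \sum_h1 \sum_h2 D h1 h2 <= 12 * (q * (q * (N * N))))%N.
  apply: leq_trans (_ : 100 * (\sum_i (\sum_h1 \sum_h2 line_dist f Lam (x + i *: h)%R (h1 + i *: h2)%R
                                + \sum_h1 \sum_h2 y h1 h2 i)) <= _)%N.
    rewrite leq_pmul2l //.
    apply: leq_trans (_ : \sum_h1 \sum_h2 \sum_i
      (line_dist f Lam (x + i *: h)%R (h1 + i *: h2)%R + y h1 h2 i) <= _)%N.
      by do 2 (apply: leq_sum => ? _); apply: leD.
    under eq_bigr do rewrite exchange_big /=; rewrite exchange_big /=.
    apply: leq_sum => i _; under eq_bigr do rewrite big_split /=.
    by rewrite big_split.
  rewrite big_distrr /= mulnCA -sum_const_all; apply: leq_sum => i _.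
  rewrite mulnDr sumy exchange_big /=.
  have le1 : (100 * \sum_h2 \sum_h1 line_dist f Lam (x + i *: h)%R (h1 + i *: h2)%R <= 11 * (q * (N * N)))%N.
    have -> : (11 * (q * (N * N)) = N * (11 * (q * N)))%N by ring.
    rewrite big_distrr /= -sum_const_all; apply: leq_sum => h2 _.
    rewrite (sum_translate (i *: h2) (line_dist f Lam (x + i *: h))).
    exact: line_dist_sum.
  have le2 : (100 * (#|Fx| * err) <= q * (N * N))%N.
    by rewrite mulnCA leq_mul // mulnn.
  by move: le1 le2; move: (q * (N * N))%N (\sum_h2 _)%N (#|Fx| * err)%N => u v w; lia.
(* The average of [T] over [h1, h2] is at most
   [(43 * 0.12 + 21 * 0.13 + 21 * 0.01 + 10 * 0.13) q^2 = 9.4 q^2]. *)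
pose T h1 h2 := (43 * D h1 h2 + 21 * (q * Z h1 h2) + 21 * (q * y h1 h2 i0) + 10 * (q * q * z h1 h2))%N.
have [[h1 h2] /= ltT] : exists h12 : V * V, (T h12.1 h12.2 < 10 * (q * q))%N.
  apply: sum_lt_exists; rewrite card_prod -(pair_bigA _ T) /=.
  rewrite -(ltn_pmul2l (m := 100)) //.
  have -> : (\sum_h1 \sum_h2 T h1 h2 = 43 * (\sum_h1 \sum_h2 D h1 h2)
      + 21 * (q * \sum_h1 \sum_h2 Z h1 h2) + 21 * (q * \sum_h1 \sum_h2 y h1 h2 i0)
      + 10 * (q * q * \sum_h1 \sum_h2 z h1 h2))%N.
    under eq_bigr do rewrite 3!big_split -!big_distrr /=.
    by rewrite 3!big_split -!big_distrr /=.
  have w0 : (0 < q * q * (N * N))%N by rewrite !muln_gt0 q0 N0.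
  have b1 := sumD.
  have b2 : (100 * (q * \sum_h1 \sum_h2 Z h1 h2) <= 13 * (q * (q * (N * N))))%N.
    by rewrite mulnCA [leqRHS]mulnCA leq_mul // mulnCA.
  have b3 : (100 * (q * \sum_h1 \sum_h2 y h1 h2 i0) <= q * (q * (N * N)))%N.
    rewrite sumy mulnCA leq_mul // mulnCA leq_mul // mulnn //.
  have b4 : (100 * (q * q * \sum_h1 \sum_h2 z h1 h2) <= 13 * (q * (q * (N * N))))%N.
    have -> : (13 * (q * (q * (N * N))) = q * q * (13 * (N * N)))%N by ring.
    by rewrite mulnCA leq_mul // sumZ1.
  move: b1 b2 b3 b4 w0; rewrite -!mulnA.
  by move: (\sum_h1 _)%N (q * \sum_h1 _)%N (q * \sum_h1 _)%N (q * (q * \sum_h1 _))%N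
     (q * (q * (N * N)))%N => s1 s2 s3 s4 w; lia.
(* The weight [10 * (q * q)] of [z] in [T] already reaches the bound, so [z] must be 0. *)
have z0 : (A h1 h2 i0).[0] = g (x + i0 *: h).
  by apply/eqP/negPn/negP => ne; move: ltT; rewrite /T /z ne muln1 ltnNge leq_addl.
have [|||||||Q [sQ sYQ bR bC]] := @bivariate_low_degree F (A h1 h2) (B h1 h2) setT Fx d.
- by move=> i; apply: szL.
- by move=> i; apply: szL.
- exact: d0.
- exact: ltq.
- by rewrite cardsT.
- by rewrite cardsC1_succ.
- by move: ltT; rewrite /T -/(D h1 h2) -mulnn; move: (D h1 h2) (q * q)%N (q * Z _ _)%N (q * y _ _ _)%N (q * q * z _ _)%N => D' qq zz yy z'; lia.
have [|e1 _] := @edge_recovered Q (B h1 h2) (x + i0 *: h) (h1 + i0 *: h2) i0 sYQ.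
  apply: threshold_arith q0 bC _; rewrite -/(D h1 h2) -/(y h1 h2 i0) -mulnn.
  by move: ltT; rewrite /T; move: (D h1 h2) (q * q)%N (q * Z _ _)%N (q * y _ _ _)%N (q * q * z _ _)%N => D' qq zz yy z'; lia.
exists (swapXY Q).[0%:P]; split.
- by rewrite horner_swapXY; apply: leq_trans (size_poly _ _) sQ.
- by rewrite horner2_swapXY -z0 /A e1.
have : (41 * (#|[set i in setT | Q.[i%:P] != A h1 h2 i]| + Z h1 h2) < 20 * q)%N.
  apply: threshold_arith q0 bR _; rewrite -/(D h1 h2) -mulnn.
  by move: ltT; rewrite /T; move: (D h1 h2) (q * q)%N (q * Z _ _)%N (q * y _ _ _)%N (q * q * z _ _)%N => D' qq zz yy z'; lia.
apply: leq_ltn_trans; rewrite leq_pmul2l //.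
have -> : Z h1 h2 = #|[set i | (A h1 h2 i).[0] != g (x + i *: h)]|.
  rewrite /Z -sum1_card [RHS]big_mkcond /=; apply: eq_bigr => i _; by rewrite inE; case: (_ != _).
apply: leq_trans (leq_of_leqif (leq_card_setU _ _)); apply: subset_leq_card.
apply/subsetP => i; rewrite !inE /= horner2_swapXY; apply: contraR; rewrite negb_or !negbK.
by case/andP => /eqP-> /eqP->.
Qed.

(** The polynomials obtained for two choices of [i0] each miss [g] on fewer than 20 q / 41 points,
    so they agree on more than q / 41 > d points and coincide. *)
Lemma center_line_degree : line_degree d g.
Proof.
move=> x h; have [p [sp _ ltp]] := line_points_surface x h 0; exists p => // t.
have [p' [sp' -> ltp']] := line_points_surface x h t.
suff -> : p' = p by [].
apply/eqP/negPn/negP => ne; have := card_poly_agree sp' sp ne.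
have : (q <= #|[set i | g (x + i *: h)%R != p.[i]%R]| + (#|[set i | g (x + i *: h)%R != p'.[i]%R]|
     + #|[set i | p'.[i]%R == p.[i]%R]|))%N.
  rewrite -cardsT.
  apply: leq_trans (leq_add (leqnn _) (leq_of_leqif (leq_card_setU _ _))).
  apply: leq_trans (leq_of_leqif (leq_card_setU _ _)); apply: subset_leq_card.
  apply/subsetP => i _; rewrite !inE.
  by case: eqP => //= <-; case: eqP => //= <-; rewrite eqxx.
move: ltp ltp' ltq d0; move: #|_| #|_| #|_| q; lia.
Qed.
End Family.

(** * From a lines oracle to a family of line polynomials *)

Definition line_agree (F : finFieldType) (m : nat) (f : 'rV[F]_m -> F) (b u : 'rV[F]_m)
    (p : {poly F}) : {set F} := [set t | f (b + t *: u) == p.[t]].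

Lemma line_agree_overlap (F : finFieldType) (m d : nat) (f : 'rV[F]_m -> F) b u (p p' : {poly F}) :
  (size p <= d.+1)%N -> (size p' <= d.+1)%N -> p != p' ->
  (#|line_agree f b u p| + #|line_agree f b u p'| <= #|F| + d)%N.
Proof.
move=> sp sp' ne; rewrite -cardsUI leq_add ?max_card //.
apply: leq_trans (card_poly_agree sp sp' ne); apply: subset_leq_card.
by apply/subsetP => t; rewrite !inE => /andP[/eqP<- /eqP<-].
Qed.

Lemma size_comp_linear (F : idomainType) (p q : {poly F}) n :
  (size q <= 2)%N -> (size p <= n.+1)%N -> (size (p \Po q) <= n.+1)%N.
Proof.
move=> sq sp; apply: leq_trans (size_comp_poly_leq _ _) _; rewrite ltnS.
have h1 : ((size p).-1 <= n)%N by move: sp; case: (size p).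
have h2 : ((size q).-1 <= 1)%N by move: sq; case: (size q).
by rewrite (leq_trans (leq_mul h1 h2)) ?muln1.
Qed.

Lemma line_agree_shift (F : finFieldType) (m : nat) (f : 'rV[F]_m -> F) b u s (p : {poly F}) :
  #|line_agree f (b + s *: u) u (p \Po ('X + s%:P))| = #|line_agree f b u p|.
Proof.
rewrite -(card_imset (mem (line_agree f (b + s *: u) u _)) (addIr s)).
apply: eq_card => t; apply/imsetP/idP => [[r]|].
  rewrite !inE horner_comp !hornerE => /eqP e ->; rewrite -e; apply/eqP; congr f.
  by rewrite scalerDl addrA addrAC.
rewrite inE => e; exists (t - s); last by rewrite subrK.
by rewrite inE horner_comp !hornerE subrK scalerBl addrACA subrr addr0.
Qed.

(** A polynomial replaced by a different majority one agreed with [f] on fewer points of the line,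
    by [line_agree_overlap]. So the error decreases line by line. *)
Lemma majority_correction (F : finFieldType) (m d : nat) (f : 'rV[F]_m -> F) Lam0 :
  lines_family d Lam0 ->
  exists Lam, [/\ lines_family d Lam, majority_closed d f Lam &
                  (family_err f Lam <= family_err f Lam0)%N].
Proof.
move=> fam0; have [sz0 inv0] := fam0.
pose maj b u (p : {poly F}) := (#|F| + d < 2 * #|line_agree f b u p|)%N.
pose Lam b u : {poly F} := if [pick v : 'rV[F]_d.+1 | maj b u (rVpoly v)] is Some v
                then rVpoly v else Lam0 b u.
have uniq_maj b u (p p' : {poly F}) : (size p <= d.+1)%N -> (size p' <= d.+1)%N ->
    maj b u p -> maj b u p' -> p = p'.
  move=> sp sp' mp mp'; apply/eqP/negPn/negP => ne.
  have := line_agree_overlap f b u sp sp' ne; move: mp mp'; rewrite /maj.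
  by move: #|line_agree _ _ _ _| #|line_agree _ _ _ _| #|F|; lia.
have sLam b u : (size (Lam b u) <= d.+1)%N.
  by rewrite /Lam; case: pickP => // v _; apply: size_poly.
have closed : majority_closed d f Lam.
  move=> b u p sp mp; rewrite /Lam; case: pickP => [v mv|none].
    by apply: (@uniq_maj b u) => //; apply: size_poly.
  by have := none (poly_rV p); rewrite poly_rV_K // /maj mp.
have sXs (s : F) : (size ('X + s%:P)%R <= 2)%N by rewrite size_XaddC.
have shift_maj b u s p : maj b u p -> maj (b + s *: u) u (p \Po ('X + s%:P)).
  by rewrite /maj line_agree_shift.
have invL b u s t : (Lam (b + s *: u) u).[t] = (Lam b u).[t + s].
  rewrite {2}/Lam; case: pickP => [v mv|none].
    rewrite (closed _ _ (rVpoly v \Po ('X + s%:P))) ?horner_comp ?hornerE //.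
      by apply: size_comp_linear => //; apply: size_poly.
    exact: shift_maj.
  (* A majority polynomial at the shifted base point would shift back to one at [b]. *)
  rewrite /Lam; case: pickP => [v mv|_]; last exact: inv0.
  have sv : (size (rVpoly v \Po ('X + (- s)%:P))%R <= d.+1)%N.
    by apply: size_comp_linear => //; apply: size_poly.
  have := shift_maj _ _ (- s) _ mv; rewrite scaleNr addrK => mb.
  by have := none (poly_rV (rVpoly v \Po ('X + (- s)%:P))); rewrite poly_rV_K // mb.
have famL : lines_family d Lam by [].
exists Lam; split=> //.
have q0 : (0 < #|F|)%N by apply/card_gt0P; exists 0.
(* Multiplying by [q] spreads the test over all points of each line. *)
rewrite -(leq_pmul2l q0) -!sum_const_all.
rewrite (eq_bigr _ (fun t _ => esym (family_err_shift f t famL))).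
rewrite [leqRHS](eq_bigr _ (fun t _ => esym (family_err_shift f t fam0))).
rewrite exchange_big [leqRHS]exchange_big /=; apply: leq_sum => b _.
rewrite exchange_big [leqRHS]exchange_big /=; apply: leq_sum => u _.
have disE (p : {poly F}) : (\sum_t (f (b + t *: u)%R != p.[t]) + #|line_agree f b u p| = #|F|)%N.
  rewrite -[#|line_agree f b u p|]sum1_card [X in (_ + X)%N]big_mkcond /= -big_split /=.
  rewrite -[RHS]muln1 -sum_const_all; apply: eq_bigr => t _.
  by rewrite inE; case: (_ == _).
case: (eqVneq (Lam b u) (Lam0 b u)) => [->//|ne].
have mL : maj b u (Lam b u).
  by move: ne; rewrite /Lam; case: pickP => //; rewrite eqxx.
have := line_agree_overlap f b u (sLam b u) (sz0 b u) ne.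
have := disE (Lam b u); have := disE (Lam0 b u); move: mL; rewrite /maj.
move: (\sum_t _)%N (\sum_t _)%N #|line_agree _ _ _ _| #|line_agree _ _ _ _| #|F|; lia.
Qed.

Lemma line_shift (F : finFieldType) (m : nat) (b u : 'rV[F]_m) s : line (b + s *: u) u = line b u.
Proof.
apply/setP => z; apply/imsetP/imsetP => [] [t _ ->].
  by exists (s + t); rewrite // scalerDl addrA.
by exists (t - s); rewrite // scalerBl -addrA [s *: u + _]addrC subrK.
Qed.

Lemma line_scale (F : finFieldType) (m : nat) (b u : 'rV[F]_m) c :
  c != 0 -> line b (c *: u) = line b u.
Proof.
move=> c0; apply/setP => z; apply/imsetP/imsetP => [] [t _ ->].
  by exists (t * c); rewrite // scalerA.
by exists (t / c); rewrite // scalerA divfK.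
Qed.

Lemma line_base (F : finFieldType) (m : nat) (b u : 'rV[F]_m) : b \in line b u.
Proof. by apply/imsetP; exists 0; rewrite // scale0r addr0. Qed.

Lemma line_through_base (F : finFieldType) (m : nat) (b a v : 'rV[F]_m) :
  b \in line a v -> line a v = line b v.
Proof. by case/imsetP => s _ ->; rewrite line_shift. Qed.

Lemma line_eq_dir (F : finFieldType) (m : nat) (b u v : 'rV[F]_m) :
  line b u = line b v -> exists c, u = c *: v.
Proof.
move=> e; have : b + u \in line b u by apply/imsetP; exists 1; rewrite // scale1r.
by rewrite e => /imsetP[c _ /addrI->]; exists c.
Qed.

Lemma lines_oracle_family (F : finFieldType) (m d : nat) (f : 'rV[F]_m -> F) P :
  lines_oracle d P ->
  exists2 Lam, lines_family d Lam &
    family_err f Lam = (\sum_b #|[set u | (u != 0%R) && (f b != P (line b u) b)]|)%N.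
Proof.
move=> orc.
have ex (bu : 'rV[F]_m * 'rV[F]_m) : exists p : {poly F}, (size p <= d.+1)%N /\
    forall t, p.[t] = if bu.2 == 0 then f bu.1 else P (line bu.1 bu.2) (bu.1 + t *: bu.2).
  case: bu => b u /=; case: eqP => [_|/eqP u0].
    (* The degenerate direction gets the constant [f b] and causes no error. *)
    by exists (f b)%:P; split=> [|t]; rewrite ?hornerC // (leq_trans (size_polyC_leq1 _)).
  have [|a [v [p [v0 eL sp ep]]]] := orc (line b u).
    by apply/existsP; exists b; apply/existsP; exists u; rewrite u0 eqxx.
  have bL : b \in line a v by rewrite -eL line_base.
  have [c uc] : exists c, u = c *: v by apply: (line_eq_dir (b := b)); rewrite eL (line_through_base bL).
  case/imsetP: bL => s _ bs.
  (* With b = a + s v and u = c v, b + t u = a + (c t + s) v. *)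
  exists (p \Po (c *: 'X + s%:P)); split.
    apply: size_comp_linear => //; apply: leq_trans (size_polyD _ _) _.
    rewrite geq_max (leq_trans (size_scale_leq _ _)) ?size_polyX //=.
    by rewrite (leq_trans (size_polyC_leq1 _)).
  move=> t; rewrite horner_comp !hornerE -ep; congr P.
  by rewrite {1}bs uc scalerDl scalerA [c * t]mulrC -addrA [s *: v + _]addrC.
have [L hL] := fin_all_exists ex.
exists (fun b u => L (b, u)).
  split=> [b u|b u s t]; first by case: (hL (b, u)).
  rewrite !(hL _).2 /=; case: eqP => [->|_]; first by rewrite scaler0 addr0.
  by rewrite line_shift [t + s]addrC scalerDl addrA.
rewrite /family_err; apply: eq_bigr => b _; rewrite -sum1_card [RHS]big_mkcond /=.
apply: eq_bigr => u _; rewrite inE (hL _).2 /=; case: (eqVneq u 0) => [_|_] /=; first by rewrite eqxx.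
by rewrite scale0r addr0; case: (_ != _).
Qed.

(** Each line through [b] has exactly q - 1 nonzero direction vectors. *)
Lemma card_directions (F : finFieldType) (m : nat) (b : 'rV[F]_m) (X : pred {set 'rV[F]_m}) :
  (#|[set u | (u != 0%R) && X (line b u)]| =
   #|[set~ (0%R : F)]| * #|[set L in lines_through b | X L]|)%N.
Proof.
rewrite -sum1_card (partition_big (fun u => line b u) (mem [set L in lines_through b | X L])) /=.
  rewrite mulnC -sum_nat_const; apply: eq_bigr => L.
  rewrite !inE => /andP[/andP[/existsP[a /existsP[v /andP[v0 /eqP eL]]] bL] XL].
  rewrite eL in bL; move: eL; rewrite (line_through_base bL) => eL.
  rewrite sum1_card -(card_imset (mem [set~ (0 : F)]) (f := fun c => c *: v)); last first.
    move=> c c' /eqP; rewrite -subr_eq0 -scalerBl scaler_eq0 (negPf v0) orbF subr_eq0.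
    by move/eqP.
  apply: eq_card => u; rewrite unfold_in /= !inE; apply/idP/imsetP.
    case/andP=> /andP[u0 _] /eqP; rewrite eL => /line_eq_dir[c uc]; exists c => //.
    by rewrite !inE; apply: contraNneq u0 => c0; rewrite uc c0 scale0r.
  case=> c; rewrite !inE => c0 ->; rewrite scaler_eq0 (negPf c0) (negPf v0) /=.
  by rewrite line_scale // -eL XL eqxx.
move=> u; rewrite !inE => /andP[u0 Xu]; rewrite Xu line_base !andbT.
by apply/existsP; exists b; apply/existsP; exists u; rewrite u0 eqxx.
Qed.

(** Averaging over all directions, zero included, gives at most the average over lines, because q -
    1 times the number of lines through a point is at most [N]. *)
Lemma family_err_le (R : realFieldType) (F : finFieldType) (m d : nat) (f : 'rV[F]_m -> F) P
    (delta : R) :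
  lines_oracle d P -> 0 < delta -> line_point_err R f P <= delta ->
  exists2 Lam, lines_family d Lam &
    (family_err f Lam)%:R <= delta * (#|'rV[F]_m| ^ 2)%:R.
Proof.
move=> orc dpos le; have [Lam fam eE] := lines_oracle_family f orc; exists Lam => //.
set N := #|'rV[F]_m| in le *.
have N0 : (0 < N)%N by apply/card_gt0P; exists 0.
have NR : 0 < N%:R :> R by rewrite ltr0n.
rewrite /line_point_err ler_pdivrMl // -/N in le.
rewrite eE natr_sum -mulnn natrM [delta * _]mulrC -mulrA; apply: le_trans (ler_wpM2l (ltW NR) le).
rewrite mulr_sumr; apply: ler_sum => b _.
set K := #|lines_through b|; set bad := #|[set L in lines_through b | f b != P L b]|.
have -> : #|[set u | (u != 0) && (f b != P (line b u) b)]| = (#|[set~ (0%R : F)]| * bad)%N.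
  exact: (card_directions b (fun L => f b != P L b)).
have leN : (#|[set~ (0%R : F)]| * K <= N)%N.
  have := card_directions b predT; rewrite /= => e.
  have -> : K = #|[set L in lines_through b | predT L]|.
    by apply: eq_card => L; rewrite !inE andbT.
  by rewrite -e max_card.
case: (posnP K) => [K0|Kpos].
  have -> : bad = 0%N.
    apply/eqP; rewrite -leqn0 -K0; apply: subset_leq_card.
    by apply/subsetP => L; rewrite inE => /andP[].
  by rewrite muln0 !mulr0.
rewrite mulrA natrM; apply: ler_wpM2r; first exact: ler0n.
by rewrite ler_pdivlMr ?ltr0n // -natrM ler_nat.
Qed.

Lemma point_err_leq (R : realFieldType) (F : finFieldType) (m : nat) (f : 'rV[F]_m -> F)
    (Q : {mpoly F[m]}) (E : nat) (delta : R) :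
  0 < delta -> E%:R <= delta * (#|'rV[F]_m| ^ 2)%:R ->
  (#|'rV[F]_m| * #|[set a | f a != mpeval Q a]| <= 4 * E)%N ->
  point_err R f Q <= 4 * delta.
Proof.
move=> dpos leE; set N := #|'rV[F]_m| in leE *; set M := #|_| => leM.
have NR : 0 < N%:R :> R by rewrite ltr0n; apply/card_gt0P; exists 0.
rewrite /point_err ler_pdivrMr // -(ler_pM2l NR) -natrM.
apply: le_trans (_ : (4 * E)%:R <= _); first by rewrite ler_nat.
apply: le_trans (_ : 4 * (delta * (N ^ 2)%:R) <= _); first by rewrite natrM ler_pM2l.
by rewrite -mulnn natrM le_eqVlt; apply/orP; left; apply/eqP; ring.
Qed.

(** Constant line polynomials force f(b) = f(b + u) up to twice the error; an average base point
    supplies the constant. *)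
Lemma degree0_case (F : finFieldType) (m : nat) (f : 'rV[F]_m -> F) Lam :
  lines_family 0 Lam ->
  exists c, (#|'rV[F]_m| * #|[set a | f a != c]| <= 2 * family_err f Lam)%N.
Proof.
move=> fam; have [sz _] := fam; set N := #|'rV[F]_m|; set E := family_err f Lam.
have tot : (\sum_a \sum_u (f a != f (a + u)%R) <= 2 * E)%N.
  rewrite mul2n -addnn /E -{1}(family_err_shift f 0 fam) -(family_err_shift f 1 fam) -big_split /=.
  apply: leq_sum => a _; rewrite -big_split /=; apply: leq_sum => u _.
  have := neq_split (Lam a u).[0] (f a) (f (a + u)).
  have -> : (Lam a u).[1] = (Lam a u).[0] by rewrite (size1_polyC (sz a u)) !hornerC.
  by rewrite scale0r addr0 scale1r ![_ == (Lam a u).[0]]eq_sym.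
have [|a lt] := @sum_lt_exists 'rV[F]_m (fun a => N * \sum_u (f a != f (a + u)%R))%N (2 * E).+1.
  rewrite -big_distrr /= mulnC ltn_pmul2r ?ltnS //; apply/card_gt0P; by exists 0.
exists (f a); rewrite -ltnS; apply: leq_ltn_trans lt; rewrite leq_mul //.
rewrite -sum1_card big_mkcond /= -(sum_translate a); apply: leq_sum => u _.
by rewrite inE addrC eq_sym; case: (_ != _).
Qed.

Theorem theorem1p2 :
  exists C : nat,
  forall (R : realFieldType) (F : finFieldType) (m d : nat),
    (0 < m)%N -> (C * d < #|F|)%N ->
  forall (f : 'rV[F]_m -> F) (P : {set 'rV[F]_m} -> 'rV[F]_m -> F) (delta : R),
    lines_oracle d P ->
    0 < delta -> delta < 1 / 100 ->
    line_point_err R f P <= delta ->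
  exists Q : {mpoly F[m]},
    (msize Q <= d.+1)%N /\ point_err R f Q <= 4 * delta.
Proof.
(* A generous constant: q / 91 must absorb multiples of [d] in the bivariate test, and q / 41 must
   absorb [d] and a lost point in the majority arguments. *)
exists 1000%N => R F m d _ ltq f P delta orc dpos dlt le.
have [Lam0 fam0 leE0] := family_err_le orc dpos le.
(* For d = 0 the bound on [q] does not make the field large, so surfaces are avoided. *)
case: (posnP d) => [d_eq0|d0].
  rewrite {}d_eq0 {ltq orc d} in fam0 *.
  have [c hc] := degree0_case f fam0; exists c%:MP; split.
    by rewrite mmeasureC; case: (_ != _).
  apply: (point_err_leq dpos leE0).
  have -> : [set a | f a != mpeval c%:MP a] = [set a | f a != c].
    by apply/setP => a; rewrite !inE /mpeval mevalC.
  by apply: leq_trans hc _; rewrite leq_mul2r orbT.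
have [Lam [fam maj leE]] := majority_correction f fam0.
have leR : (family_err f Lam)%:R <= delta * (#|'rV[F]_m| ^ 2)%:R.
  by apply: le_trans leE0; rewrite ler_nat.
have small : (100 * family_err f Lam <= #|'rV[F]_m| ^ 2)%N.
  rewrite -(ler_nat R) natrM; apply: le_trans (ler_wpM2l (ler0n _ _) leR) _.
  rewrite mulrA; apply: ler_piMl; first exact: ler0n.
  by rewrite mulrC; move: dlt; rewrite ltr_pdivlMr ?ltr0n // => /ltW.
have [g gP] := fin_all_exists (center_exists d0 ltq fam maj small).
have ltq2 : (2 * d < #|F|)%N by move: ltq; lia.
have [Q sQ eQ] := line_degree_polynomial ltq2 (center_line_degree d0 ltq fam maj small gP).
exists Q; split=> //; apply: (point_err_leq dpos leR).
have -> : [set a | f a != mpeval Q a] = [set a | f a != g a].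
  by apply/setP => a; rewrite !inE eQ.
(* The factor obtained is 100 / 87, well below 4. *)
have := family_err_center f gP.
move: (#|'rV[F]_m| * _)%N (family_err f Lam) => u v; lia.
Qed.
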